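(* For every fixed $k,m\in\mathbb N$ the following problem is decidable: given finite alphabets $A,B$ and a timed automaton with $\varepsilon$-transitions recognising (with Büchi acceptance) a timed $\omega$-language $W\subseteq (A\times B\times\mathbb R_{\ge0})^\omega$ over the alphabet $A\times B$, decide whether Player II has a winning $k,m$-controller in the timed synthesis game $G(A,B,W)$.
   Context: Timed words and clock constraints: a timed word over $\Sigma$ is a sequence $(a_1,t_1)(a_2,t_2)\cdots$, $a_i\in\Sigma$, $0\le t_1\le t_2\le\cdots$ reals; clock constraints over clocks $X$ are Boolean combinations of $x\sim z$, $x-y\sim z$ ($z\in\mathbb Z$, $\sim\in\{<,\le,=,\ge,>\}$). A timed automaton with $\varepsilon$-transitions $(\Sigma,L,X,I,F,\Delta)$ has rules $(p,a,\varphi,Y,q)$, $a\in\Sigma\cup\{\varepsilon\}$, taken after a time elapse when the current valuation satisfies $\varphi$, resetting $Y$ to $0$; runs start in $I$ with all clocks $0$. Its timed $\omega$-language consists of the infinite timed words over $\Sigma$ obtained, by deleting $\varepsilon$-letters, from infinite accepted words (runs visiting $F$ infinitely often), keeping only infinite results. For a set of clocks $X$ and $m\in\mathbb N$, two valuations are $(X,m)$-region equivalent if they satisfy the same clock constraints over $X$ with constants of absolute value at most $m$; the equivalence classes (finitely many) are regions. Timed synthesis game $G(A,B,W)$: in rounds $i=1,2,\dots$ Player I chooses $a_i\in A$ and $t_i\in\mathbb R_{\ge0}$ with $t_i\ge t_{i-1}$ ($t_0=0$), then Player II chooses $b_i\in B$; Player I wins iff the play $(a_1,b_1,t_1)(a_2,b_2,t_2)\cdots\in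 W$. A $k,m$-controller for Player II is $(A,B,L,\ell_0,\delta)$ with finite memory set $L$, $\ell_0\in L$, a set $X$ of $k$ clocks, and $\delta: L\times A\times\mathrm{Regions}(X,m)\to L\times B\times 2^X$. It plays as follows: starting from $\ell_0$ and the all-zero valuation $\mu_0$, on Player I's move $(a_{n+1},t_{n+1})$ with current $(\ell_n,\mu_n)$, let $\nu=\mu_n+(t_{n+1}-t_n)$ and $\delta(\ell_n,a_{n+1},[\nu])=(\ell',b,Y)$; it answers $b_{n+1}=b$ and updates to $\ell_{n+1}=\ell'$, $\mu_{n+1}=\nu$ with clocks in $Y$ reset to $0$. It is winning if no infinite play consistent with it belongs to $W$. *)

(* Defs.v *)
From Stdlib Require Import Reals ZArith.
From mathcomp Require Import ssreflect ssrfun ssrbool eqtype ssrnat seq choice fintype finset.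

Set Implicit Arguments.
Unset Strict Implicit.
Unset Printing Implicit Defensive.

(* 1. A model of computation: partial recursive (mu-recursive) functions    *)
(*    on nat, in unary form using the Cantor pairing function.              *)

Definition cpair (a b : nat) : nat := ((a + b) * (a + b).+1)./2 + b.

Inductive code : Type :=
  | CZero
  | CSucc
  | CFst
  | CSnd
  | CComp (f g : code)
  | CPair (f g : code)
  | CRec (f g : code)
  | CMu (f : code).

Inductive eval : code -> nat -> nat -> Prop :=
  | eZero n : eval CZero n 0
  | eSucc n : eval CSucc n n.+1
  | eFst a b : eval CFst (cpair a b) a
  | eSnd a b : eval CSnd (cpair a b) b
  | eComp f g n m k : eval g n m -> eval f m k -> eval (CComp f g) n k
  | ePair f g n a b : eval f n a -> eval g n b -> eval (CPair f g) n (cpair a b)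
  | eRec0 f g x a : eval f x a -> eval (CRec f g) (cpair x 0) a
  | eRecS f g x n a b :
      eval (CRec f g) (cpair x n) a ->
      eval g (cpair x (cpair n a)) b ->
      eval (CRec f g) (cpair x n.+1) b
  | eMu f x n :
      eval f (cpair x n) 0 ->
      (forall i, i < n -> exists v, v <> 0 /\ eval f (cpair x i) v) ->
      eval (CMu f) x n.

Definition computably_decidable (X : Type) (enc : X -> nat) (P : X -> Prop) : Prop :=
  exists c : code, forall x : X,
    (P x -> eval c (enc x) 1) /\ (~ P x -> eval c (enc x) 0).

(*    Clocks and locations are named by natural numbers; the clocks / locations *)
(*    of an automaton are those occurring in it.                             *)

Inductive cmp : Type := CLt | CLe | CEq | CGe | CGt.

Inductive guard : Type :=
  | GTrue
  | GAtom (x : nat) (c : cmp) (z : Z)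
  | GDiff (x y : nat) (c : cmp) (z : Z)
  | GNot (g : guard)
  | GAnd (g1 g2 : guard)
  | GOr (g1 g2 : guard).

(* a rule (p, a, phi, Y, q); the label is None for epsilon, Some (a, b) for the
   letter (a, b) of the alphabet A x B = 'I_nA x 'I_nB. *)
Record rule : Type := Rule {
  r_src : nat;
  r_lab : option (nat * nat);
  r_guard : guard;
  r_reset : seq nat;
  r_dst : nat }.

Record TA : Type := MkTA {
  ta_init : seq nat;
  ta_final : seq nat;
  ta_rules : seq rule }.

(* An instance of the decision problem: sizes of the alphabets A = 'I_nA,
   B = 'I_nB, and a timed automaton over A x B. *)
Record instance : Type := Inst {
  i_nA : nat;
  i_nB : nat;
  i_ta : TA }.

Definition enc_Z (z : Z) : nat :=
  if (0 <=? z)%Z then cpair 0 (Z.to_nat z) else cpair 1 (Z.to_nat (- z)).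

Definition enc_cmp (c : cmp) : nat :=
  match c with CLt => 0 | CLe => 1 | CEq => 2 | CGe => 3 | CGt => 4 end.

Fixpoint enc_guard (g : guard) : nat :=
  match g with
  | GTrue => cpair 0 0
  | GAtom x c z => cpair 1 (cpair x (cpair (enc_cmp c) (enc_Z z)))
  | GDiff x y c z => cpair 2 (cpair x (cpair y (cpair (enc_cmp c) (enc_Z z))))
  | GNot g1 => cpair 3 (enc_guard g1)
  | GAnd g1 g2 => cpair 4 (cpair (enc_guard g1) (enc_guard g2))
  | GOr g1 g2 => cpair 5 (cpair (enc_guard g1) (enc_guard g2))
  end.

Fixpoint enc_seq (T : Type) (f : T -> nat) (s : seq T) : nat :=
  match s with
  | [::] => 0
  | x :: s' => (cpair (f x) (enc_seq f s')).+1
  end.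

Definition enc_lab (l : option (nat * nat)) : nat :=
  match l with None => 0 | Some (a, b) => (cpair a b).+1 end.

Definition enc_rule (r : rule) : nat :=
  cpair (r_src r) (cpair (enc_lab (r_lab r))
    (cpair (enc_guard (r_guard r)) (cpair (enc_seq id (r_reset r)) (r_dst r)))).

Definition enc_TA (T : TA) : nat :=
  cpair (enc_seq id (ta_init T)) (cpair (enc_seq id (ta_final T)) (enc_seq enc_rule (ta_rules T))).

Definition enc_instance (I : instance) : nat :=
  cpair (i_nA I) (cpair (i_nB I) (enc_TA (i_ta I))).

Definition cmpR (c : cmp) (u v : R) : Prop :=
  match c with
  | CLt => (u < v)%R | CLe => (u <= v)%R | CEq => u = v
  | CGe => (u >= v)%R | CGt => (u > v)%R
  end.

Fixpoint sat (nu : nat -> R) (g : guard) : Prop :=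
  match g with
  | GTrue => True
  | GAtom x c z => cmpR c (nu x) (IZR z)
  | GDiff x y c z => cmpR c (nu x - nu y)%R (IZR z)
  | GNot g1 => ~ sat nu g1
  | GAnd g1 g2 => sat nu g1 /\ sat nu g2
  | GOr g1 g2 => sat nu g1 \/ sat nu g2
  end.

Definition prev (t : nat -> R) (n : nat) : R :=
  match n with 0 => 0%R | n'.+1 => t n' end.

(* clock valuation of a run (rules r taken at absolute times s) just before
   the j-th step's time elapse; all clocks start at 0. *)
Fixpoint run_val (r : nat -> rule) (s : nat -> R) (j : nat) : nat -> R :=
  match j with
  | 0 => fun _ => 0%R
  | j'.+1 => fun x =>
      if x \in r_reset (r j') then 0%R
      else (run_val r s j' x + (s j' - prev s j'))%R
  end.

(* infinite accepting (Buchi) run of T, as the sequence of rules taken and the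
   (absolute) times at which they are taken *)
Definition accepting_run (T : TA) (r : nat -> rule) (s : nat -> R) : Prop :=
  r_src (r 0) \in ta_init T /\
  (forall j, List.In (r j) (ta_rules T)) /\
  (forall j, r_dst (r j) = r_src (r j.+1)) /\
  (forall j, (prev s j <= s j)%R) /\
  (forall j, sat (fun x => (run_val r s j x + (s j - prev s j))%R) (r_guard (r j))) /\
  (forall N, exists j, N <= j /\ r_src (r j) \in ta_final T).

Definition timed_word (nA nB : nat) : Type := nat -> ('I_nA * 'I_nB) * R.

(* The timed omega-language of T: infinite words over A x B obtained from the
   infinite words of accepting runs by deleting epsilon letters, keeping only
   infinite results (f enumerates, increasingly, exactly the non-epsilon
   positions, of which there must be infinitely many). *)
Definition in_lang (nA nB : nat) (T : TA) (w : timed_word nA nB) : Prop :=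
  exists (r : nat -> rule) (s : nat -> R) (f : nat -> nat),
    accepting_run T r s /\
    (forall i, f i < f i.+1) /\
    (forall j, r_lab (r j) <> None <-> exists i, f i = j) /\
    (forall i, r_lab (r (f i)) = Some (nat_of_ord (w i).1.1, nat_of_ord (w i).1.2)
               /\ s (f i) = (w i).2).

Fixpoint guard_over (k m : nat) (g : guard) : Prop :=
  match g with
  | GTrue => True
  | GAtom x _ z => x < k /\ (Z.abs z <= Z.of_nat m)%Z
  | GDiff x y _ z => x < k /\ y < k /\ (Z.abs z <= Z.of_nat m)%Z
  | GNot g1 => guard_over k m g1
  | GAnd g1 g2 | GOr g1 g2 => guard_over k m g1 /\ guard_over k m g2
  end.

Definition ext_val (k : nat) (nu : 'I_k -> R) (x : nat) : R :=
  match (insub x : option 'I_k) with Some y => nu y | None => 0%R end.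

Definition region_equiv (k m : nat) (nu nu' : 'I_k -> R) : Prop :=
  forall g, guard_over k m g -> (sat (ext_val nu) g <-> sat (ext_val nu') g).

(* delta : L x A x Regions(X,m) -> L x B x 2^X, presented as a function on
   valuations that is constant on (X,m)-regions *)
Definition region_invariant (k m nA nB : nat) (L : Type)
    (delta : L -> 'I_nA -> ('I_k -> R) -> L * 'I_nB * {set 'I_k}) : Prop :=
  forall l a nu nu', region_equiv m nu nu' -> delta l a nu = delta l a nu'.

Section Controller.
Variables (k nA nB : nat) (L : Type) (l0 : L)
  (delta : L -> 'I_nA -> ('I_k -> R) -> L * 'I_nB * {set 'I_k})
  (a : nat -> 'I_nA) (t : nat -> R).

Definition elapse (mu : 'I_k -> R) (n : nat) : 'I_k -> R :=
  fun x => (mu x + (t n - prev t n))%R.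

(* controller state (l_n, mu_n) before answering the n-th move (0-indexed) *)
Fixpoint ctrl_state (n : nat) : L * ('I_k -> R) :=
  match n with
  | 0 => (l0, fun _ => 0%R)
  | n'.+1 =>
      let: (l, mu) := ctrl_state n' in
      let nu := elapse mu n' in
      let: (l', _, Y) := delta l (a n') nu in
      (l', fun x => if x \in Y then 0%R else nu x)
  end.

Definition ctrl_out (n : nat) : 'I_nB :=
  let: (l, mu) := ctrl_state n in (delta l (a n) (elapse mu n)).1.2.

End Controller.

Definition has_winning_controller (k m : nat) (I : instance) : Prop :=
  exists (L : finType) (l0 : L)
         (delta : L -> 'I_(i_nA I) -> ('I_k -> R) -> L * 'I_(i_nB I) * {set 'I_k}),
    region_invariant m delta /\
    forall (a : nat -> 'I_(i_nA I)) (t : nat -> R),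
      (forall n, (prev t n <= t n)%R) ->
      ~ in_lang (i_ta I)
          (fun n => ((a n, ctrl_out l0 delta a t n), t n) : ('I_(i_nA I) * 'I_(i_nB I)) * R).

(* Main.v *)
(** A controller only observes the region of its clocks, so it wins the timed game iff it
    wins a finite game: Player I plays a letter and a region of the controller clocks,
    Player II answers with a letter and a set of resets, and Player I wins iff some run of
    the automaton, over the regions of all clocks, fits the play and visits a final
    location infinitely often.  Recording the current time and the last reset times instead
    of the clock values, a region is determined by comparing differences of time stamps with
    bounded integers, and it has a representative on a fixed finite integer grid.

    A winning finite-memory strategy is certified by ranks: for each memory state and each
    automaton state, a bound on the number of accepting letters still to come.  The memory
    can be bounded a priori: keep, as in Safra's construction, a list of sets of automaton
    states ordered by age, and always play as the state of the given controller that
    lexicographically minimises the maximal ranks of these sets.  Along an accepting run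
    the rank of some eventually stable set would decrease infinitely often.  Hence there is
    a winning controller iff there is a certificate below a computable bound, and being a
    certificate is expressed by a formula with bounded quantifiers only. *)

From Stdlib Require Import Cantor ZArith Reals Lra.
From mathcomp Require Import all_boot zify boolp.
Require Import Defs.

Set Implicit Arguments.
Unset Strict Implicit.
Unset Printing Implicit Defensive.
Delimit Scope R_scope with R.

(** * Sequences *)

Definition infinitely_often (P : nat -> Prop) := forall N, exists n, N <= n /\ P n.

Lemma homo_leq_from (T : Type) (r : T -> T -> Prop) (u : nat -> T) n0 :
  (forall x, r x x) -> (forall y x z, r x y -> r y z -> r x z) ->
  (forall n, n0 <= n -> r (u n) (u n.+1)) ->
  forall i j, n0 <= i -> i <= j -> r (u i) (u j).
Proof.
move=> r_refl r_trans r_step i j n0i ij.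
have n0j := leq_trans n0i ij.
apply: (@homo_leq_in _ [pred n | n0 <= n] u r) => // [n n' n0n _ l /andP[/ltnW nl _]|n n0n _].
  exact: leq_trans nl.
exact: r_step.
Qed.

Lemma bounded_nondecreasing_stable (u : nat -> nat) b n0 :
  (forall n, n0 <= n -> u n <= u n.+1) -> (forall n, u n <= b) ->
  exists n1, n0 <= n1 /\ forall n, n1 <= n -> u n = u n1.
Proof.
move=> u_step u_le; pose value v := `[< exists n, n0 <= n /\ u n = v >].
have value_u n : n0 <= n -> value (u n) by move=> n0n; apply/asboolP; exists n.
have ex_value : exists v, value v by exists (u n0); apply: value_u.
have value_le v : value v -> v <= b by move=> /asboolP[n [_ <-]].
case: (ex_maxnP ex_value value_le) => _ /asboolP[n1 [n0n1 <-]] u_max.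
exists n1; split=> // n n1n; apply/eqP.
rewrite eqn_leq u_max ?value_u //=; last exact: leq_trans n1n.
by apply: (homo_leq_from (r := fun x y => x <= y) _ _ u_step) => // y x z; apply: leq_trans.
Qed.

Lemma no_infinite_descent (u : nat -> nat) n0 :
  (forall n, n0 <= n -> u n.+1 <= u n) -> ~ infinitely_often (fun n => u n.+1 < u n).
Proof.
move=> u_step u_drop; pose value v := `[< exists n, n0 <= n /\ u n = v >].
have ex_value : exists v, value v by exists (u n0); apply/asboolP; exists n0.
case: (ex_minnP ex_value) => _ /asboolP[n1 [n0n1 <-]] u_min.
have [n [n1n drop]] := u_drop n1.
have n0n := leq_trans n0n1 n1n.
have u_le : u n <= u n1.
  apply: (homo_leq_from (r := fun x y => y <= x) _ _ u_step) => // y x z yx zy.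
  exact: leq_trans yx.
have : u n1 <= u n.+1 by apply: u_min; apply/asboolP; exists n.+1; split=> //; apply: leqW.
by rewrite leqNgt (leq_trans drop).
Qed.

Lemma least_infinitely_often (P : nat -> nat -> Prop) b :
  infinitely_often (fun n => exists2 i, i < b & P n i) ->
  exists i, [/\ i < b, infinitely_often (P^~ i) &
    exists n0, forall n j, n0 <= n -> P n j -> i <= j].
Proof.
elim: b => [|b IHb] inf_ltS; first by have [n [_ []]] := inf_ltS 0.
have [/IHb[i [ib infi mini]]|] := EM (infinitely_often (fun n => exists2 i, i < b & P n i)).
  by exists i; split=> //; apply: leqW.
move=> /existsNP[n0 none_lt].
have P_ge n j : n0 <= n -> P n j -> b <= j.
  move=> n0n Pnj; rewrite leqNgt; apply/negP => jb.
  by apply: none_lt; exists n; split=> //; exists j.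
exists b; split=> //; last by exists n0.
move=> N; have [n [Nn [i ib Pni]]] := inf_ltS (maxn N n0).
exists n; rewrite (leq_trans (leq_maxl _ _) Nn); split=> //.
have bi := P_ge n i (leq_trans (leq_maxr _ _) Nn) Pni.
by have -> : b = i by apply/eqP; rewrite eqn_leq bi -ltnS.
Qed.

Lemma dependent_choice (X : Type) (inv : nat -> X -> Prop) (step : nat -> X -> X -> Prop) x0 :
  inv 0 x0 -> (forall n x, inv n x -> exists y, inv n.+1 y /\ step n x y) ->
  exists u, [/\ u 0 = x0, forall n, inv n (u n) & forall n, step n (u n) (u n.+1)].
Proof.
move=> inv0 inv_step.
have /choice[next nextP] (nx : nat * X) :
    exists y, inv nx.1 nx.2 -> inv nx.1.+1 y /\ step nx.1 nx.2 y.
  have [/inv_step[y ?]|] := EM (inv nx.1 nx.2); last by exists nx.2.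
  by exists y.
pose u := fix u n := if n is n'.+1 then next (n', u n') else x0.
have invu n : inv n (u n) by elim: n => // n /(nextP (n, u n))[].
by exists u; split=> // n; have [] := nextP (n, u n) (invu n).
Qed.

Section Enumeration.
Variable P : nat -> bool.

Fixpoint ncount j := if j is j'.+1 then ncount j' + P j' else 0.

Definition enumerates (f : nat -> nat) :=
  (forall i, f i < f i.+1) /\ forall j, P j <-> exists i, f i = j.

Lemma leq_ncount i j : i <= j -> ncount i <= ncount j.
Proof. by apply: (homo_leq leqnn leq_trans) => l; apply: leq_addr. Qed.

Lemma ncount_skip i j : i <= j -> (forall l, i <= l -> l < j -> ~~ P l) -> ncount j = ncount i.
Proof.
move=> ij; rewrite -(subnKC ij); elim: (j - i) => [|d IHd] none; first by rewrite addn0.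
rewrite addnS /= (negbTE (none (i + d) _ _)) ?leq_addr ?addnS // addn0.
by apply: IHd => l il l_lt; apply: none => //; rewrite addnS leqW.
Qed.

Lemma ncount_enum f i : enumerates f -> ncount (f i) = i.
Proof.
case=> f_lt fP; have f_mono := leq_mono (homo_ltn ltn_trans f_lt).
have letter_f l : P (f l) by apply/fP; exists l.
elim: i => [|i IHi].
  apply: (@ncount_skip 0) => // l _; apply: contraTN => /fP[i <-].
  by rewrite -leqNgt f_mono.
rewrite (@ncount_skip (f i).+1) // => [|l]; first by rewrite /= IHi letter_f addn1.
move=> f_l; apply: contraTN => /fP[i' lE]; move: f_l; rewrite -lE -!leqNgt f_mono.
by rewrite (leqW_mono f_mono).
Qed.

Lemma enum_ncount f j : enumerates f -> P j -> f (ncount j) = j.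
Proof. by move=> enum_f /(proj2 enum_f)[i <-]; rewrite ncount_enum. Qed.

Lemma enum_infinitely_often f : enumerates f -> infinitely_often (fun j => P j).
Proof.
case=> f_lt fP N; exists (f N); split; last by apply/fP; exists N.
by elim: N => // N IHN; apply: leq_ltn_trans (f_lt N).
Qed.

Lemma infinitely_often_enum : infinitely_often (fun j => P j) -> exists f, enumerates f.
Proof.
move=> infP; have unbounded i : exists j, i < ncount j.+1.
  elim: i => [|i [j i_lt]]; first by have [j [_ Pj]] := infP 0; exists j; rewrite /= Pj addn1.
  have [l [jl Pl]] := infP j.+1; exists l; rewrite /= Pl addn1 ltnS.
  exact: leq_trans i_lt (leq_ncount jl).
pose f i := ex_minn (unbounded i).
have f_gt i : i < ncount (f i).+1 by rewrite /f; case: ex_minnP.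
have f_min i j : i < ncount j.+1 -> f i <= j.
  by rewrite /f; case: ex_minnP => l _ l_min; apply: l_min.
have f_le i : ncount (f i) <= i.
  by case E: (f i) => [//|j]; rewrite leqNgt; apply/negP => /f_min; rewrite E ltnn.
have fP i : P (f i) /\ ncount (f i) = i.
  by have := f_gt i; have := f_le i; rewrite /=; case: (P (f i)); lia.
exists f; split=> [i|j].
  rewrite ltnNge; apply/negP => /leq_ncount.
  by rewrite (proj2 (fP i)) (proj2 (fP i.+1)) ltnn.
split=> [Pj|[i <-]]; last by have [] := fP i.
exists (ncount j); apply/eqP; rewrite eqn_leq f_min /= ?Pj ?addn1 //=.
by rewrite leqNgt; apply/negP => /leq_ncount; rewrite leqNgt f_gt.
Qed.
End Enumeration.

Section Flag.
Variables letter final flag : nat -> bool.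
Hypothesis flagS : forall j, flag j.+1 = ~~ letter j && (flag j || final j).

Lemma flagged_letters : infinitely_often (fun j => letter j) ->
  infinitely_often (fun j => final j) ->
  infinitely_often (fun j => letter j && (flag j || final j)).
Proof.
move=> inf_letter inf_final N; have [j [Nj final_j]] := inf_final N.
have ex_letter : exists l, (j <= l) && letter l.
  by have [l [jl letter_l]] := inf_letter j; exists l; rewrite jl.
case: (ex_minnP ex_letter) => l /andP[jl letter_l] l_min.
exists l; rewrite letter_l (leq_trans Nj jl); split=> //=.
suff raised i : j <= i -> i <= l -> flag i || final i by apply: raised.
elim: i => [|i IHi]; first by rewrite leqn0 => /eqP <-; rewrite final_j orbT.
rewrite leq_eqVlt => /predU1P[<-|]; first by rewrite final_j orbT.
rewrite ltnS => ji il; rewrite flagS IHi ?(ltnW il) //= andbT.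
suff -> : letter i = false by [].
by apply/negP => letter_i; have := l_min i; rewrite ji letter_i leqNgt il => /(_ isT).
Qed.

Lemma flagged_final : infinitely_often (fun j => letter j && (flag j || final j)) ->
  infinitely_often (fun j => final j).
Proof.
move=> inf_flagged N; have [j [Nj /andP[letter_j _]]] := inf_flagged N.
have [l [jl /andP[_ raised_l]]] := inf_flagged j.+1.
apply: contrapT => no_final.
have not_final i : N <= i -> final i = false.
  by move=> Ni; apply/negP => final_i; apply: no_final; exists i.
suff lowered i : j < i -> flag i = false by rewrite lowered // not_final // in raised_l; lia.
elim: i => // i IHi; rewrite ltnS leq_eqVlt => /predU1P[<-|ji]; first by rewrite flagS letter_j.
by rewrite flagS IHi // not_final ?andbF //; lia.
Qed.
End Flag.

Section Lexicographic.
Variable B : nat.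
Implicit Types d e : nat -> nat.

Fixpoint lexval d i : nat := if i is i'.+1 then lexval d i' * B + d i' else 0.

Lemma leq_lexval d e i : (forall j, j < i -> d j <= e j) -> lexval d i <= lexval e i.
Proof.
elim: i => //= i IHi de; rewrite leq_add ?de // leq_mul2r IHi ?orbT // => j ji.
by apply: de; apply: leqW.
Qed.

Lemma eq_lexval d e i : (forall j, j < i -> d j = e j) -> lexval d i = lexval e i.
Proof. by elim: i => //= i IHi de; rewrite de // IHi // => j ji; apply: de; apply: leqW. Qed.

Lemma leq_lexval_prefix d e i j : (forall l, e l < B) -> j <= i ->
  lexval d i <= lexval e i -> lexval d j <= lexval e j.
Proof.
move=> eB; elim: i => [|i IHi]; first by rewrite leqn0 => /eqP ->.
rewrite leq_eqVlt => /predU1P[-> //|]; rewrite ltnS => ji /= le_i.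
by apply: IHi => //; have := eB i; nia.
Qed.

Lemma lexval_inj d e i : (forall l, d l < B) -> (forall l, e l < B) ->
  lexval d i = lexval e i -> forall j, j < i -> d j = e j.
Proof.
move=> dB eB; elim: i => //= i IHi eq_i.
have eq_prefix : lexval d i = lexval e i by have := dB i; have := eB i; nia.
move=> j; rewrite ltnS leq_eqVlt => /predU1P[->|]; last exact: IHi.
by move: eq_i; rewrite eq_prefix; lia.
Qed.

Lemma ltn_lexval_extend d e i j : (forall l, d l < B) -> j <= i ->
  lexval d j < lexval e j -> lexval d i < lexval e i.
Proof.
move=> dB; elim: i => [|i IHi]; first by rewrite leqn0 => /eqP ->.
rewrite leq_eqVlt => /predU1P[-> //|]; rewrite ltnS => ji lt_j /=.
by have := IHi ji lt_j; have := dB i; nia.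
Qed.

Lemma leq_lexval_extend d e i j : (forall l, j <= l -> d l <= e l) -> j <= i ->
  lexval d j <= lexval e j -> lexval d i <= lexval e i.
Proof.
move=> de; elim: i => [|i IHi]; first by rewrite leqn0 => /eqP ->.
rewrite leq_eqVlt => /predU1P[-> //|]; rewrite ltnS => ji le_j /=.
by have := IHi ji le_j; have := de i ji; nia.
Qed.

Lemma lexval_lt d i : (forall l, d l < B) -> lexval d i < B ^ i.
Proof. by move=> dB; elim: i => //= i IHi; rewrite expnSr; have := dB i; nia. Qed.

Lemma lexval_cons d i : lexval d i.+1 = d 0 * B ^ i + lexval (d \o S) i.
Proof.
elim: i => [|i IHi]; first by rewrite /= expn0 muln1 addn0.
by rewrite [LHS]/= -/(lexval d i.+1) IHi /= expnSr; lia.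
Qed.
End Lexicographic.

(** * Lassos and ranks in finite graphs *)

Section Lasso.
Variables (V : finType) (init : pred V) (plain accepting : rel V).
Let edge := [rel v v' | plain v v' || accepting v v'].

Definition lasso :=
  exists x y z, [/\ init x, connect edge x y, accepting y z & connect edge z y].

Definition accepting_path (p : nat -> V) := [/\ init (p 0), forall n, edge (p n) (p n.+1) &
  infinitely_often (fun n => accepting (p n) (p n.+1))].

(* The path is produced by a walker that carries the vertices remaining before y; at y it
   takes the accepting edge to z and reloads the path from z to y. *)
Lemma lasso_path : lasso -> exists p, accepting_path p.
Proof.
case=> x [y [z [init_x /connectP[s path_s last_s] acc_yz /connectP[c path_c last_c]]]].
pose step (w : V * seq V) := if w.2 is v :: s' then (v, s') else (z, c).
pose w n := iter n step (x, s).
have w_to_y n : path edge (w n).1 (w n).2 /\ last (w n).1 (w n).2 = y.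
  elim: n => //= n; rewrite -/(w n) /step; case: (w n) => v [|v' s'] //= [/andP[_ ->] ->] //.
exists (fun n => (w n).1); split=> [//|n|N].
  have := w_to_y n; rewrite /= -/(w n) /step; case: (w n) => v [|v' s'] /= [path_v last_v].
    by rewrite last_v acc_yz orbT.
  by case/andP: path_v.
suff [n [Nn at_y]] : exists n, N <= n /\ (w n).2 = [::].
  exists n; split=> //; have := w_to_y n; rewrite /= -/(w n) /step.
  by case: (w n) at_y => v _ /= -> [_ /= ->].
have [l] := ubnP (size (w N).2); elim: l N => // l IHl N.
case: (posnP (size (w N).2)) => [/size0nil at_y _|walking]; first by exists N.
move=> size_l; have [|n [Nn at_y]] := IHl N.+1.
  by move: walking size_l; rewrite /= -/(w N) /step; case: (w N).2.
by exists n; split=> //; apply: ltnW.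
Qed.

Definition rank v := #|[set u | connect edge v u && [exists z, accepting u z]]|.

Lemma leq_rank v v' : edge v v' -> rank v' <= rank v.
Proof.
move=> vv'; apply/subset_leq_card/subsetP => u; rewrite !inE => /andP[v'u ->].
by rewrite andbT; apply: connect_trans v'u; apply: connect1.
Qed.

Lemma ltn_rank v v' : ~ lasso -> [exists x, init x && connect edge x v] ->
  accepting v v' -> rank v' < rank v.
Proof.
move=> no_lasso /existsP[x /andP[init_x xv]] acc_vv'.
have vv' : edge v v' by rewrite /= acc_vv' orbT.
apply: proper_card; apply/properP; split.
  apply/subsetP => u; rewrite !inE => /andP[v'u ->].
  by rewrite andbT; apply: connect_trans v'u; apply: connect1.
exists v; rewrite !inE ?connect0 /=; first by apply/existsP; exists v'.
by apply/negP => /andP[v'v _]; apply: no_lasso; exists x, v, v'.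
Qed.

Lemma rank_max v : rank v <= #|V|.
Proof. exact: max_card. Qed.
End Lasso.

(** * Safra trees as lists of sets ordered by age *)

Section Tree.
Variable Q : finType.
Implicit Types (S : {set Q}) (T U V : seq {set Q}) (q : Q) (i j : nat).

Definition member_bit T q i : nat := q \in nth set0 T i.
Definition signature T q i := lexval 2 (member_bit T q) i.
Definition active T q := has (fun S => q \in S) T.
Definition later T q i := active (drop i.+1 T) q.
Definition nonempty : pred {set Q} := predC1 set0.
Definition compress T := filter nonempty T.
Definition nonempty_prefix T i := (i < size T) && all nonempty (take i.+1 T).
Definition laminar : rel {set Q} := fun S S' => (S' \subset S) || [disjoint S & S'].
Definition safra_tree T := [&& pairwise laminar T, all nonempty T & size T <= #|Q|].

(* A state of the i-th set that also lies in a younger set has read an accepting letter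
   since the i-th set was last green; counting it one higher makes the rank of the i-th
   set drop exactly when the set becomes green. *)
Definition node_rank T (rho : Q -> nat) i := \max_(q in nth set0 T i) (rho q + later T q i).

Lemma member_bit_lt2 T q i : member_bit T q i < 2.
Proof. by rewrite /member_bit; case: (_ \in _). Qed.

Lemma nth_set0_size T q i : q \in nth set0 T i -> i < size T.
Proof. by move=> qi; rewrite ltnNge; apply: contraTN qi => ?; rewrite nth_default ?inE. Qed.

Lemma nonempty_size T i : nonempty (nth set0 T i) -> i < size T.
Proof. by case/set0Pn=> q; apply: nth_set0_size. Qed.

Lemma activeP T q : reflect (exists i, q \in nth set0 T i) (active T q).
Proof.
apply: (iffP hasP) => [[S ST qS]|[i qi]]; first by exists (index S T); rewrite nth_index.
by exists (nth set0 T i) => //; rewrite mem_nth // (nth_set0_size qi).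
Qed.

Lemma laterP T q i : reflect (exists2 j, i < j & q \in nth set0 T j) (later T q i).
Proof.
apply: (iffP (activeP _ _)) => [[l]|[j ij qj]].
  by rewrite nth_drop => ql; exists (i.+1 + l) => //; rewrite leq_addr.
by exists (j - i.+1); rewrite nth_drop subnKC.
Qed.

Lemma mem_signature T U q q' i j : signature T q i = signature U q' i -> j < i ->
  (q \in nth set0 T j) = (q' \in nth set0 U j).
Proof.
move=> eq_sig ji; have := lexval_inj (member_bit_lt2 T q) (member_bit_lt2 U q') eq_sig ji.
by rewrite /member_bit; do 2 case: (_ \in _).
Qed.

Lemma node_rank_lt T rho b i : (forall q, rho q < b) -> node_rank T rho i < b.+1.
Proof.
move=> rho_b; rewrite ltnS; apply/bigmax_leqP => q _.
by have := rho_b q; case: (later _ _ _); lia.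
Qed.

Lemma active_compress V q : active (compress V) q = active V q.
Proof.
rewrite /active has_filter -filter_predI -has_filter; apply: eq_in_has => S _ /=.
by rewrite /nonempty /=; case: eqP => [->|_]; rewrite ?inE ?andbT.
Qed.

Lemma signature_cons S V q i :
  signature (S :: V) q i.+1 = (q \in S) * 2 ^ i + signature V q i.
Proof. exact: lexval_cons. Qed.

Lemma leq_signature_compress q V i : signature V q i <= signature (compress V) q i.
Proof.
elim: V i => [|S V IHV] [|i] //.
rewrite /compress /= -/(compress V); case: ifPn => [_|/negbNE/eqP->].
  by rewrite !signature_cons leq_add2l; apply: IHV.
rewrite signature_cons inE mul0n add0n; apply: leq_trans (IHV i) _.
by rewrite /signature /=; lia.
Qed.

Lemma signature_compress_nonempty q V i :
  signature V q i.+1 = signature (compress V) q i.+1 ->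
  q \in nth set0 (compress V) i -> nonempty_prefix V i.
Proof.
elim: V i => [|S V IHV] i; first by rewrite nth_nil inE.
rewrite /compress /= -/(compress V); case: ifPn => [S_ne|/negbNE/eqP->].
  case: i => [|i]; first by rewrite /nonempty_prefix /= S_ne take0.
  rewrite signature_cons [in RHS]signature_cons => /addnI eq_sig.
  by case/(IHV i eq_sig)/andP=> iV ne; rewrite /nonempty_prefix /= ltnS iV S_ne.
rewrite signature_cons inE mul0n add0n => eq_sig qi.
have := leq_signature_compress q V i.
by move: eq_sig; rewrite /signature /= {3}/member_bit qi; lia.
Qed.

Lemma leq_nonempty_prefix V i j : j <= i -> nonempty_prefix V i -> nonempty_prefix V j.
Proof.
move=> ji /andP[iV]; rewrite -(subnKC (ji : j < i.+1)) takeD all_cat => /andP[ne _].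
by rewrite /nonempty_prefix ne (leq_ltn_trans ji iV).
Qed.

Lemma compress_prefix V i : nonempty_prefix V i ->
  compress V = take i.+1 V ++ compress (drop i.+1 V).
Proof.
by case/andP=> _ /all_filterP ne; rewrite -{1}(cat_take_drop i.+1 V) /compress filter_cat ne.
Qed.

Lemma nth_compress V i : nonempty_prefix V i -> nth set0 (compress V) i = nth set0 V i.
Proof.
move=> ne; have /andP[iV _] := ne.
by rewrite (compress_prefix ne) nth_cat size_takel // ltnS leqnn nth_take.
Qed.

Lemma later_compress V q i : nonempty_prefix V i -> later (compress V) q i = later V q i.
Proof.
move=> ne; have /andP[iV _] := ne.
by rewrite /later (compress_prefix ne) drop_size_cat ?active_compress // size_takel.
Qed.

Lemma node_rank_compress V rho i : nonempty_prefix V i ->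
  node_rank (compress V) rho i = node_rank V rho i.
Proof.
move=> ne; rewrite /node_rank nth_compress //; apply: eq_bigr => q _.
by rewrite later_compress.
Qed.

Definition compressed_index V i := size (compress (take i V)).

Lemma leq_compressed_index V i : compressed_index V i <= i.
Proof.
rewrite /compressed_index size_filter; apply: leq_trans (count_size _ _) _.
by rewrite size_take_min geq_minl.
Qed.

Lemma ltn_compressed_index V i j : nonempty_prefix V i -> i < j -> i < compressed_index V j.
Proof.
case/andP=> iV ne ij; rewrite /compressed_index -(subnKC ij) takeD /compress filter_cat.
by rewrite (all_filterP ne) size_cat size_takel // leq_addr.
Qed.

Lemma nth_compressed_index V i : nonempty (nth set0 V i) ->
  nth set0 (compress V) (compressed_index V i) = nth set0 V i /\
  compressed_index V i < size (compress V).
Proof.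
move=> ne; have iV := nonempty_size ne.
have -> : compress V = compress (take i V) ++ nth set0 V i :: compress (drop i.+1 V).
  by rewrite -{1}(cat_take_drop i V) /compress filter_cat (drop_nth set0 iV) /= ne.
by rewrite nth_cat ltnn subnn size_cat /= addnS ltnS leq_addr.
Qed.

Lemma leq_size_compress T :
  (forall i, nonempty (nth set0 T i) -> exists2 q, q \in nth set0 T i & ~~ later T q i) ->
  size (compress T) <= #|\bigcup_(S <- T) S|.
Proof.
elim: T => [|S T IHT] owner //=; rewrite big_cons.
have {}IHT : size (compress T) <= #|\bigcup_(S <- T) S| by apply: IHT => i; apply: (owner i.+1).
rewrite /compress /=; case: ifP => [S_ne|_]; last first.
  by apply: leq_trans IHT _; apply/subset_leq_card/subsetUr.
have [q /= qS] := owner 0 S_ne; rewrite /later /= drop0 => q_inactive.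
apply: leq_ltn_trans IHT _; apply: proper_card; apply/properP; split; first exact: subsetUr.
exists q; first by rewrite inE qS.
apply: contra q_inactive; elim: T {owner} => [|S' T IHT]; first by rewrite big_nil inE.
by rewrite big_cons inE /= => /orP[->//|/IHT ->]; rewrite orbT.
Qed.

(* As in Safra's construction, a set covered by younger sets absorbs their states. *)
Definition green U i := [forall q in nth set0 U i, later U q i].
Definition absorbed U q i := [exists j : 'I_i, green U j && (q \in nth set0 U j)].
Definition tree_trunc U :=
  mkseq (fun i => [set q in nth set0 U i | ~~ absorbed U q i]) (size U).

Lemma absorbedP U q i :
  reflect (exists j, [/\ j < i, green U j & q \in nth set0 U j]) (absorbed U q i).
Proof.
apply: (iffP existsP) => [[j /andP[green_j qj]]|[j [ji green_j qj]]]; first by exists j.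
by exists (Ordinal ji); rewrite /= green_j.
Qed.

Lemma mem_trunc U q i :
  (q \in nth set0 (tree_trunc U) i) = (q \in nth set0 U i) && ~~ absorbed U q i.
Proof.
case: (ltnP i (size U)) => iU; first by rewrite nth_mkseq // !inE.
by rewrite !nth_default ?size_mkseq // inE.
Qed.

Lemma later_trunc U q i : later (tree_trunc U) q i -> later U q i.
Proof. by case/laterP=> j ij; rewrite mem_trunc => /andP[qj _]; apply/laterP; exists j. Qed.

Lemma pairwise_laminar_trunc U : pairwise laminar U -> pairwise laminar (tree_trunc U).
Proof.
move/(pairwiseP set0) => lamU; apply/(pairwiseP set0) => i j; rewrite !inE size_mkseq => iU jU ij.
have absorbed_le q : absorbed U q i -> absorbed U q j.
  by case/absorbedP=> l [li green_l ql]; apply/absorbedP; exists l; split=> //; apply: ltn_trans ij.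
case/orP: (lamU i j iU jU ij) => [/subsetP sub|/pred0P disj]; apply/orP.
  left; apply/subsetP => q; rewrite !mem_trunc => /andP[/sub-> kept].
  by apply: contra kept; apply: absorbed_le.
right; apply/pred0P => q /=; rewrite !mem_trunc; apply/negP => /andP[/andP[qi _] /andP[qj _]].
by have := disj q; rewrite /= qi qj.
Qed.

Lemma trunc_owner U i : pairwise laminar U -> nonempty (nth set0 (tree_trunc U) i) ->
  exists2 q, q \in nth set0 (tree_trunc U) i & ~~ later (tree_trunc U) q i.
Proof.
move=> lamU /set0Pn[y]; rewrite mem_trunc => /andP[yi y_kept].
have [green_i|] := boolP (green U i).
  exists y; first by rewrite mem_trunc yi.
  apply/laterP => -[j ij]; rewrite mem_trunc => /andP[_ /absorbedP[]].
  by exists i.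
rewrite negb_forall => /existsP[q]; rewrite negb_imply => /andP[qi q_notlater].
exists q; last exact: contra (@later_trunc U q i) q_notlater.
rewrite mem_trunc qi; apply: contra y_kept => /absorbedP[j [ji green_j qj]].
apply/absorbedP; exists j; split=> //.
have := pairwiseP set0 lamU j i; rewrite !inE (nth_set0_size qj) (nth_set0_size qi).
case/(_ isT isT ji)/orP => [/subsetP -> //|/pred0P /(_ q)].
by rewrite /= qj qi.
Qed.

Lemma safra_tree_trunc U : pairwise laminar U -> safra_tree (compress (tree_trunc U)).
Proof.
move=> lamU; apply/and3P; split; first exact/pairwise_filter/pairwise_laminar_trunc.
  exact: filter_all.
by apply: leq_trans (leq_size_compress _) (max_card _) => i; apply: trunc_owner.
Qed.
End Tree.
Arguments nonempty {Q}.
Arguments laminar {Q}.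

Section TreeStep.
Variables (Q : finType) (trans : Q -> bool -> Q -> bool).
Implicit Types (S : {set Q}) (T : seq {set Q}) (q : Q) (c : Q * bool) (i j : nat).

(* Predecessors are compared lexicographically, oldest set first; an accepting letter
   counts as one more, youngest, set. *)
Definition predecessor_value T c := (signature T c.1 (size T)).*2 + c.2.
Definition predecessor T q' c := active T c.1 && trans c.1 c.2 q'.
Definition best T q' : option (Q * bool) :=
  [pick c | predecessor T q' c &&
    [forall c', predecessor T q' c' ==> (predecessor_value T c' <= predecessor_value T c)]].

Definition fresh_states T := [seq q' <- enum Q | oapp snd false (best T q')].
Definition tree_succ T :=
  [seq [set q' | oapp (fun c => c.1 \in A) false (best T q')] | A : {set Q} <- T] ++
  [seq [set q'] | q' <- fresh_states T].
Definition tree_step T := compress (tree_trunc (tree_succ T)).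

Lemma bestP T q' c : predecessor T q' c ->
  exists c0, [/\ best T q' = Some c0, predecessor T q' c0 &
    predecessor_value T c <= predecessor_value T c0].
Proof.
move=> pred_c; rewrite /best; case: pickP => [c0 /andP[pred_c0 /forallP max_c0]|none].
  by exists c0; split=> //; have /implyP := max_c0 c; apply.
have [c0 pred_c0 max_c0] := @arg_maxnP _ c (predecessor T q') (predecessor_value T) pred_c.
by have /negP[] := none c0; rewrite pred_c0; apply/forallP => c'; apply/implyP/max_c0.
Qed.

Lemma best_predecessor T q' c : best T q' = Some c -> predecessor T q' c.
Proof. by rewrite /best; case: pickP => // c0 /andP[pred_c0 _] [<-]. Qed.

Lemma leq_size_succ T : size T <= size (tree_succ T) <= size T + #|Q|.
Proof.
rewrite size_cat !size_map leq_addr leq_add2l size_filter.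
by apply: leq_trans (count_size _ _) _; rewrite cardE.
Qed.

Lemma mem_succ_old T q' i : i < size T ->
  (q' \in nth set0 (tree_succ T) i) = oapp (fun c => c.1 \in nth set0 T i) false (best T q').
Proof. by move=> iT; rewrite nth_cat size_map iT (nth_map set0) // inE. Qed.

Lemma mem_succ_fresh T q' i : size T <= i -> q' \in nth set0 (tree_succ T) i ->
  exists2 c, best T q' = Some c & c.2.
Proof.
move=> Ti q'i; have i_lt := nth_set0_size q'i; move: q'i.
rewrite nth_cat size_map ltnNge Ti /=.
have i_fresh : i - size T < size (fresh_states T) by move: i_lt; rewrite size_cat !size_map; lia.
rewrite (nth_map q') // inE => /eqP q'E; have := mem_nth q' i_fresh; rewrite -q'E mem_filter.
by case: best => // c /andP[c2 _]; exists c.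
Qed.

Lemma fresh_index T q' c : best T q' = Some c -> c.2 ->
  exists i, [/\ size T <= i, i < size (tree_succ T) & q' \in nth set0 (tree_succ T) i].
Proof.
move=> best_c c2; have fresh : q' \in fresh_states T by rewrite mem_filter best_c /= c2 mem_enum.
exists (size T + index q' (fresh_states T)).
rewrite leq_addr size_cat !size_map ltn_add2l index_mem fresh; split=> //.
rewrite nth_cat size_map ltnNge leq_addr /= addKn (nth_map q') ?index_mem //.
by rewrite nth_index // inE.
Qed.

Lemma pairwise_laminar_succ T : pairwise laminar T -> pairwise laminar (tree_succ T).
Proof.
have laminar1 S q : laminar S [set q].
  by rewrite /laminar sub1set disjoint_sym disjoints1; case: (q \in S).
move=> lamT; rewrite /tree_succ pairwise_cat; apply/and3P; split.
- by apply/allrelP => S S' _ /mapP[q _ ->].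
- rewrite pairwise_map; apply: sub_pairwise lamT => S S' /orP[/subsetP sub|/pred0P disj]; apply/orP.
    by left; apply/subsetP => q; rewrite !inE; case: best => //= c; apply: sub.
  right; apply/pred0P => q /=; rewrite !inE; case: best => //= c.
  exact: disj.
- rewrite pairwise_map; elim: (fresh_states T) => //= q s ->; rewrite andbT.
  by apply/allP => q' _; apply: laminar1.
Qed.

Lemma tree_step_safra T : safra_tree T -> safra_tree (tree_step T).
Proof. by case/and3P=> /pairwise_laminar_succ lamU _ _; apply: safra_tree_trunc. Qed.

Lemma active_step T q f q' : active T q -> trans q f q' -> active (tree_step T) q'.
Proof.
move=> active_q qq'; rewrite active_compress.
have /bestP[c [best_c /andP[/activeP[l cl] _] _]] : predecessor T q' (q, f).
  by rewrite /predecessor active_q.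
have ex_mem : exists i, q' \in nth set0 (tree_succ T) i.
  by exists l; rewrite mem_succ_old ?best_c // (nth_set0_size cl).
case: (ex_minnP ex_mem) => i q'i i_min; apply/activeP; exists i; rewrite mem_trunc q'i.
by apply/absorbedP => -[j [ji _ /i_min]]; rewrite leqNgt ji.
Qed.

Lemma active_step_predecessor T q' : active (tree_step T) q' ->
  exists q f, active T q /\ trans q f q'.
Proof.
rewrite active_compress => /activeP[i]; rewrite mem_trunc => /andP[q'i _].
have [c /best_predecessor /andP[active_c c_q']] : exists c, best T q' = Some c.
  case: (ltnP i (size T)) => [iT|Ti]; last by have [c best_c _] := mem_succ_fresh Ti q'i; exists c.
  by move: q'i; rewrite mem_succ_old //; case: best => // c _; exists c.
by exists c.1, c.2.
Qed.

Section Signature.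
Variables (T : seq {set Q}) (q : Q) (f : bool) (q' : Q).
Hypotheses (active_q : active T q) (qq' : trans q f q').

Lemma best_signature : exists c, [/\ best T q' = Some c,
  predecessor_value T (q, f) <= predecessor_value T c &
  forall i, i <= size T -> signature (tree_succ T) q' i = signature T c.1 i].
Proof.
have /bestP[c [best_c _ c_max]] : predecessor T q' (q, f) by rewrite /predecessor active_q.
exists c; split=> // i iT; apply: eq_lexval => j ji.
by rewrite /member_bit mem_succ_old ?best_c // (leq_trans ji).
Qed.

Lemma leq_signature_succ i : signature T q i <= signature (tree_succ T) q' i.
Proof.
have [c [_ c_max sigE]] := best_signature.
have le_size : signature T q (size T) <= signature T c.1 (size T).
  by move: c_max; rewrite /predecessor_value /=; case: f c.2 => [] []; lia.
case: (leqP i (size T)) => [iT|/ltnW Ti].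
  by rewrite sigE //; apply: leq_lexval_prefix iT le_size; apply: member_bit_lt2.
apply: (leq_lexval_extend _ Ti); last by rewrite -!/(signature _ _ _) sigE.
by move=> j Tj; rewrite /member_bit nth_default ?inE.
Qed.

Lemma ltn_signature_succ i : f -> size (tree_succ T) <= i ->
  signature T q i < signature (tree_succ T) q' i.
Proof.
move=> f_true Ui; have [c [best_c c_max sigE]] := best_signature.
have Ti : size T <= i by apply: leq_trans Ui; case/andP: (leq_size_succ T).
have [lt_size|ge_size] := ltnP (signature T q (size T)) (signature T c.1 (size T)).
  apply: (ltn_lexval_extend (member_bit_lt2 T q) Ti).
  by rewrite -!/(signature _ _ _) sigE.
have c2 : c.2 by move: c_max; rewrite /predecessor_value /= f_true; case: c.2; lia.
have [j [Tj jU q'j]] := fresh_index best_c c2.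
apply: (ltn_lexval_extend (j := j.+1) (member_bit_lt2 T q)); first exact: leq_trans Ui.
have qj : member_bit T q j = 0 by rewrite /member_bit nth_default ?inE.
have q'j1 : member_bit (tree_succ T) q' j = 1 by rewrite /member_bit q'j.
by have := leq_signature_succ j; rewrite /signature /= qj q'j1; lia.
Qed.
End Signature.

Section NodeRank.
Variables (T : seq {set Q}) (rho rho' : Q -> nat).
Hypothesis rho_step : forall q f q', active T q -> trans q f q' -> rho' q' + f <= rho q.

Lemma leq_rank_succ i q' : i < size T -> q' \in nth set0 (tree_succ T) i ->
  rho' q' + later (tree_succ T) q' i <= node_rank T rho i.
Proof.
move=> iT; rewrite mem_succ_old //; case best_c: best => [c|//] /= ci.
have /andP[active_c c_q'] := best_predecessor best_c.
apply: leq_trans (leq_bigmax_cond _ ci); have drop := rho_step active_c c_q'.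
have [c_later|c_notlater] := boolP (later T c.1 i); first by case: later; lia.
case: laterP => [[j ij q'j]|_]; last lia.
case: (ltnP j (size T)) => [jT|Tj].
  by case/laterP: c_notlater; exists j => //; move: q'j; rewrite mem_succ_old // best_c.
have [c' ] := mem_succ_fresh Tj q'j; rewrite best_c => -[<-] c2.
by move: drop; rewrite c2; lia.
Qed.

Lemma leq_node_rank_trunc i : i < size T ->
  node_rank (tree_trunc (tree_succ T)) rho' i <= node_rank T rho i.
Proof.
move=> iT; apply/bigmax_leqP => q; rewrite mem_trunc => /andP[qi _].
apply: leq_trans (leq_rank_succ iT qi); rewrite leq_add2l.
by have := @later_trunc _ (tree_succ T) q i; case: later => // ->.
Qed.

Lemma ltn_node_rank_trunc i : i < size T -> green (tree_succ T) i ->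
  nonempty (nth set0 (tree_trunc (tree_succ T)) i) ->
  node_rank (tree_trunc (tree_succ T)) rho' i < node_rank T rho i.
Proof.
move=> iT green_i /set0Pn[y yi].
have drop q : q \in nth set0 (tree_trunc (tree_succ T)) i ->
    rho' q + later (tree_trunc (tree_succ T)) q i < node_rank T rho i.
  rewrite mem_trunc => /andP[qi _]; have := leq_rank_succ iT qi.
  have := forallP green_i q; rewrite qi /= => ->.
  case: laterP => [[j ij]|_]; last lia.
  by rewrite mem_trunc => /andP[_ /absorbedP[]]; exists i.
have rank_gt0 : 0 < node_rank T rho i by apply: leq_ltn_trans (drop _ yi).
rewrite -(prednK rank_gt0) ltnS; apply/bigmax_leqP => q /drop.
by rewrite -{1}(prednK rank_gt0) ltnS.
Qed.
End NodeRank.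
End TreeStep.

Definition green_at (Q : finType) (trans : Q -> bool -> Q -> bool) T q' i :=
  exists g, [/\ green (tree_succ trans T) g,
    q' \in nth set0 (tree_trunc (tree_succ trans T)) g &
    i = compressed_index (tree_trunc (tree_succ trans T)) g].

Section GreenStep.
Variables (Q : finType) (trans : Q -> bool -> Q -> bool) (T : seq {set Q}).
Variables (q q' : Q) (f : bool).
Hypotheses (active_q : active T q) (qq' : trans q f q').
Let U := tree_succ trans T.
Let V := tree_trunc U.
Let T' := tree_step trans T.

Lemma green_at_mem i : safra_tree T -> green_at trans T q' i ->
  i < #|Q| /\ q' \in nth set0 T' i.
Proof.
move=> treeT; case=> g [_ q'g ->]; have [|-> index_lt] := @nth_compressed_index _ V g.
  by apply/set0Pn; exists q'.
by split=> //; apply: leq_trans index_lt _; case/and3P: (tree_step_safra trans treeT).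
Qed.

Section NoOlderGreen.
Variable i : nat.
Hypothesis no_older_green : forall j, green_at trans T q' j -> i <= j.

Lemma signature_trunc : signature V q' i.+1 = signature U q' i.+1.
Proof.
apply: eq_lexval => j ji; rewrite /member_bit mem_trunc.
case: absorbedP => [[l [lj green_l q'l]]|]; last by rewrite andbT.
have ex_green : exists l, green U l && (q' \in nth set0 U l) by exists l; rewrite green_l.
case: (ex_minnP ex_green) => g /andP[green_g q'g] g_min.
have ig : i <= compressed_index V g.
  apply: no_older_green; exists g; split=> //; rewrite mem_trunc q'g.
  apply/absorbedP => -[l' [l'g green_l' q'l']].
  by have := g_min l'; rewrite green_l' q'l' leqNgt l'g => /(_ isT).
have gl : g <= l by apply: g_min; rewrite green_l.
have := leq_trans (leq_trans ig (leq_compressed_index V g)) gl.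
by rewrite leqNgt (leq_trans lj).
Qed.

Lemma leq_signature_step : signature T q i.+1 <= signature T' q' i.+1.
Proof.
apply: leq_trans (leq_signature_compress _ _ _); rewrite signature_trunc.
exact: leq_signature_succ active_q qq' _.
Qed.

Lemma ltn_signature_step : safra_tree T -> f -> #|Q| + #|Q| <= i ->
  signature T q i.+1 < signature T' q' i.+1.
Proof.
move=> /and3P[_ _ sizeT] f_true Qi; apply: leq_trans (leq_signature_compress _ _ _).
rewrite signature_trunc.
apply: (ltn_signature_succ active_q qq' f_true).
have /andP[_ sizeU] := leq_size_succ trans T; lia.
Qed.

Lemma stable_nonempty_prefix : signature T' q' i.+1 = signature T q i.+1 ->
  q \in nth set0 T i -> nonempty_prefix V i.
Proof.
move=> sig_eq qi; apply: (@signature_compress_nonempty _ q').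
  have := leq_signature_succ active_q qq' i.+1; rewrite -/U -signature_trunc.
  have := leq_signature_compress q' V i.+1; rewrite -/(tree_step trans T) -/T' sig_eq; lia.
by rewrite (mem_signature sig_eq (ltnSn i)).
Qed.
End NoOlderGreen.

Section Stable.
Variables (rho rho' : Q -> nat) (i : nat).
Hypothesis rho_step : forall p c p', active T p -> trans p c p' -> rho' p' + c <= rho p.
Hypotheses (iT : i < size T) (prefixV : nonempty_prefix V i).

Lemma leq_node_rank_step j : j <= i -> node_rank T' rho' j <= node_rank T rho j.
Proof.
move=> ji; rewrite node_rank_compress; last exact: leq_nonempty_prefix prefixV.
exact: (leq_node_rank_trunc rho_step (leq_ltn_trans ji iT)).
Qed.

Lemma ltn_node_rank_step : green_at trans T q' i -> node_rank T' rho' i < node_rank T rho i.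
Proof.
case=> g [green_g q'g i_index].
have g_i : g = i.
  have ig : i <= g by rewrite i_index leq_compressed_index.
  apply/eqP; rewrite eqn_leq ig andbT leqNgt; apply/negP => /(ltn_compressed_index prefixV).
  by rewrite -i_index ltnn.
rewrite node_rank_compress //; apply: (ltn_node_rank_trunc rho_step iT); first by rewrite -g_i.
by apply/set0Pn; exists q'; rewrite -g_i.
Qed.
End Stable.
End GreenStep.

Section SafraRun.
Variables (Q : finType) (trans : nat -> Q -> bool -> Q -> bool).
Variables (T : nat -> seq {set Q}) (q : nat -> Q) (f : nat -> bool).
Hypotheses (tree0 : safra_tree (T 0)) (stepT : forall n, T n.+1 = tree_step (trans n) (T n)).
Hypotheses (active0 : active (T 0) (q 0)) (run : forall n, trans n (q n) (f n) (q n.+1)).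
Hypothesis accepting : infinitely_often (fun n => f n).
Let green_now n i := green_at (trans n) (T n) (q n.+1) i.

Lemma run_tree n : safra_tree (T n).
Proof. by elim: n => // n IHn; rewrite stepT tree_step_safra. Qed.

Lemma run_active n : active (T n) (q n).
Proof. by elim: n => // n IHn; rewrite stepT (active_step IHn (run n)). Qed.

Lemma signature_stable i n0 : (forall n j, n0 <= n -> green_now n j -> i <= j) ->
  exists n1, n0 <= n1 /\ forall n, n1 <= n ->
    signature (T n) (q n) i.+1 = signature (T n1) (q n1) i.+1.
Proof.
move=> no_older; apply: (@bounded_nondecreasing_stable _ (2 ^ i.+1)) => [n n0n|n].
  by rewrite stepT (leq_signature_step (run_active n) (run n)) // => j; apply: no_older.
by apply/ltnW/lexval_lt/member_bit_lt2.
Qed.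

Lemma infinitely_often_green :
  infinitely_often (fun n => exists2 i, i < #|Q| & green_now n i).
Proof.
move=> N; apply: contrapT => no_green.
have none n j : N <= n -> green_now n j -> #|Q| + #|Q| <= j.
  move=> Nn green_j; case: no_green; exists n; split=> //; exists j => //.
  by have [] := green_at_mem (run_tree n) green_j.
have [n1 [Nn1 stable]] := signature_stable none; have [n [n1n fn]] := accepting n1.
have : signature (T n) (q n) (#|Q| + #|Q|).+1 < signature (T n.+1) (q n.+1) (#|Q| + #|Q|).+1.
  rewrite stepT; apply: (ltn_signature_step (run_active n) (run n) _ (run_tree n)) => // j.
  exact: none (leq_trans Nn1 n1n).
by rewrite (stable n) // (stable n.+1) ?ltnn // leqW.
Qed.

Lemma stable_green_index : exists i n1, [/\ i < #|Q|, infinitely_often (green_now^~ i) &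
  forall n, n1 <= n ->
    i < size (T n) /\ nonempty_prefix (tree_trunc (tree_succ (trans n) (T n))) i].
Proof.
have [i [iQ green_i [n0 i_min]]] := least_infinitely_often infinitely_often_green.
have [n1 [n0n1 stable]] := signature_stable i_min.
exists i, n1; split=> // n n1n.
have qi : q n \in nth set0 (T n) i.
  have [n' [n1n' green_n']] := green_i n1.
  have [_] := green_at_mem (run_tree n') green_n'; rewrite -stepT.
  by apply: etrans; apply: mem_signature (ltnSn i); rewrite (stable n) // (stable n'.+1) ?leqW.
split; first exact: nth_set0_size qi.
apply: (stable_nonempty_prefix (run_active n) (run n) _ _ qi) => [j|].
  exact/i_min/(leq_trans n0n1).
by rewrite -stepT (stable n) // (stable n.+1) ?leqW.
Qed.

Theorem accepting_run_not_minimised (rho rho' : nat -> Q -> nat) b :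
  (forall n p, rho' n p < b) ->
  (forall n p c p', active (T n) p -> trans n p c p' -> rho' n p' + c <= rho n p) ->
  ~ forall n, lexval b.+1 (node_rank (T n.+1) (rho n.+1)) #|Q| <=
              lexval b.+1 (node_rank (T n.+1) (rho' n)) #|Q|.
Proof.
move=> rho'_lt rho_step minimised.
have [i [n1 [iQ green_i stable]]] := stable_green_index.
pose weight n := lexval b.+1 (node_rank (T n) (rho n)) i.+1.
have weightS n : weight n.+1 <= lexval b.+1 (node_rank (T n.+1) (rho' n)) i.+1.
  by apply: (leq_lexval_prefix _ iQ (minimised n)) => j; apply: node_rank_lt.
have le_rank n j : n1 <= n -> j <= i ->
    node_rank (T n.+1) (rho' n) j <= node_rank (T n) (rho n) j.
  move=> /stable[iT prefix] ji; rewrite stepT.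
  exact: (leq_node_rank_step (rho_step n) iT prefix ji).
apply: (@no_infinite_descent weight n1) => [n n1n|N].
  by apply: leq_trans (weightS n) _; apply: leq_lexval => j; rewrite ltnS; apply: le_rank.
have [n [Nn green_n]] := green_i (maxn N n1).
have [Nn' n1n] : N <= n /\ n1 <= n by apply/andP; rewrite -geq_max.
exists n; split=> //; apply: leq_ltn_trans (weightS n) _; rewrite /weight /=.
have [iT prefix] := stable n n1n.
have : node_rank (T n.+1) (rho' n) i < node_rank (T n) (rho n) i.
  by rewrite stepT; apply: (ltn_node_rank_step (rho_step n) iT prefix green_n).
have : lexval b.+1 (node_rank (T n.+1) (rho' n)) i <= lexval b.+1 (node_rank (T n) (rho n)) i.
  by apply: leq_lexval => j /ltnW; apply: le_rank.
by nia.
Qed.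
End SafraRun.

(** * Strategies with bounded memory and progress measures *)

Section Strategy.
Variables (Q In Out : finType) (init : pred Q) (eps : rel Q).
Variable letter : In -> Out -> Q -> bool -> Q -> bool.
Variables (L : finType) (l0 : L) (out : L -> In -> Out) (nxt : L -> In -> L).

Definition letter_move f : rel (L * Q) := fun v v' =>
  [exists i, (v'.1 == nxt v.1 i) && letter i (out v.1 i) v.2 f v'.2].
Definition plain_move : rel (L * Q) := fun v v' =>
  ((v.1 == v'.1) && eps v.2 v'.2) || letter_move false v v'.
Definition initial : pred (L * Q) := fun v => (v.1 == l0) && init v.2.
Definition winning := ~ lasso initial plain_move (letter_move true).

Definition move := [rel v v' | plain_move v v' || letter_move true v v'].
Definition reachable l q := [exists v, initial v && connect move v (l, q)].
Definition state_rank l q := rank plain_move (letter_move true) (l, q).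

Lemma letter_moveW f v v' : letter_move f v v' -> move v v'.
Proof. by rewrite /= /plain_move; case: f => ->; rewrite ?orbT. Qed.

Lemma letter_moveI f l i q q' : letter i (out l i) q f q' -> letter_move f (l, q) (nxt l i, q').
Proof. by move=> qq'; apply/existsP; exists i; rewrite /= eqxx. Qed.

Lemma eps_move l q q' : eps q q' -> move (l, q) (l, q').
Proof. by move=> qq'; rewrite /= /plain_move /= eqxx qq'. Qed.

Lemma reachable_init q : init q -> reachable l0 q.
Proof.
by move=> init_q; apply/existsP; exists (l0, q); rewrite /initial /= eqxx init_q connect0.
Qed.

Lemma reachable_move l q l' q' : move (l, q) (l', q') -> reachable l q -> reachable l' q'.
Proof.
move=> step /existsP[v /andP[init_v vlq]]; apply/existsP; exists v; rewrite init_v.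
by apply: connect_trans vlq _; apply: connect1.
Qed.

Lemma eps_connect_rank l q q' : connect eps q q' -> reachable l q ->
  reachable l q' /\ state_rank l q' <= state_rank l q.
Proof.
case/connectP=> s path_s -> {q'}; elim: s q path_s => //= q' s IHs q.
case/andP=> /(eps_move l) step path_s reach_q.
have [reach_last le_last] := IHs q' path_s (reachable_move step reach_q).
by split=> //; apply: leq_trans le_last _; apply: leq_rank.
Qed.

Lemma letter_rank l i q f q' : winning -> letter i (out l i) q f q' -> reachable l q ->
  reachable (nxt l i) q' /\ state_rank (nxt l i) q' + f <= state_rank l q.
Proof.
move=> win /letter_moveI step reach_q.
split; first exact: reachable_move (letter_moveW step) reach_q.
case: f step => step; first by rewrite addn1; apply: ltn_rank win reach_q step.
by rewrite addn0; apply/leq_rank/(letter_moveW step).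
Qed.
End Strategy.

(* Rank 0 marks the states that cannot occur with a given memory state. *)
Definition progress_measure (Q In Out : finType) (init : pred Q) (eps : rel Q)
    (letter : In -> Out -> Q -> bool -> Q -> bool) (L : Type) (l0 : L) (rk : L -> Q -> nat) :=
  [/\ forall q, init q -> 0 < rk l0 q,
      forall l q q', eps q q' -> 0 < rk l q -> 0 < rk l q' <= rk l q &
      forall l i, exists o l', forall q f q', letter i o q f q' -> 0 < rk l q ->
        0 < rk l' q' /\ rk l' q' + f <= rk l q].

Lemma winning_progress_measure (Q In Out : finType) (init : pred Q) (eps : rel Q)
    (letter : In -> Out -> Q -> bool -> Q -> bool) (L : finType) (l0 : L)
    (out : L -> In -> Out) (nxt : L -> In -> L) :
  winning init eps letter l0 out nxt ->
  exists2 rk, progress_measure init eps letter l0 rk & forall l q, rk l q <= (#|L| * #|Q|).+1.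
Proof.
move=> win; exists (fun l q =>
  if reachable init eps letter l0 out nxt l q then (state_rank eps letter out nxt l q).+1 else 0).
  split=> [q init_q|l q q' qq'|l i]; first by rewrite reachable_init.
    case: ifP => // reach_q _.
    by have [-> le_q'] := eps_connect_rank (connect1 qq') reach_q.
  exists (out l i), (nxt l i) => q f q' qq'; case: ifP => // reach_q _.
  by have [-> le_q'] := letter_rank win qq' reach_q.
by move=> l q; case: ifP => // _; rewrite ltnS -card_prod; apply: rank_max.
Qed.

Section BoundedMemory.
Variables (Q In Out : finType) (init : pred Q) (eps : rel Q).
Variable letter : In -> Out -> Q -> bool -> Q -> bool.

Definition closed_letter i o q f q' := [exists q1, connect eps q q1 && letter i o q1 f q'].

Definition tree_memory := {ffun 'I_#|Q| -> {set Q}}.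
Definition tree_of (mu : tree_memory) : seq {set Q} := compress (map mu (enum 'I_#|Q|)).
Definition memory_of (T : seq {set Q}) : tree_memory := [ffun i : 'I_#|Q| => nth set0 T i].
Definition tree0 := compress [:: [set q | init q]].

Lemma memory_ofK T : safra_tree T -> tree_of (memory_of T) = T.
Proof.
case/and3P=> _ all_ne sizeT; rewrite /tree_of.
have -> : map (memory_of T) (enum 'I_#|Q|) = mkseq (nth set0 T) #|Q|.
  by rewrite /mkseq -val_enum_ord -map_comp; apply: eq_map => i /=; rewrite ffunE.
rewrite -(subnKC sizeT) /mkseq iotaD map_cat /compress filter_cat -/(mkseq _ _) mkseq_nth.
rewrite (all_filterP all_ne) (eq_in_filter (a2 := pred0)) ?filter_pred0 ?cats0 // => S /mapP[i].
by rewrite mem_iota => /andP[Ti _] ->; rewrite /nonempty /= nth_default ?eqxx.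
Qed.

Lemma safra_tree0 : safra_tree tree0.
Proof.
rewrite /tree0 /compress /safra_tree /=; case: ifP => // ne; rewrite /= ne /=.
by case/set0Pn: ne => q _; rewrite (cardD1 q).
Qed.

Lemma active_tree0 q : active tree0 q = init q.
Proof. by rewrite active_compress /active /= orbF inE. Qed.

Section Reduction.
Variables (L : finType) (l0 : L) (out : L -> In -> Out) (nxt : L -> In -> L).
Hypothesis win : winning init eps letter l0 out nxt.
Let reach := reachable init eps letter l0 out nxt.
Let rho := state_rank eps letter out nxt.

Definition covers l T := [forall q, active T q ==> reach l q].
Definition weight T l := lexval (#|L| * #|Q|).+2 (node_rank T (rho l)) #|Q|.
Definition lightest (mu : tree_memory) : L :=
  if [pick l | covers l (tree_of mu)] is Some l1
  then [arg min_(l < l1 | covers l (tree_of mu)) weight (tree_of mu) l] else l0.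

Definition tree_out mu i := out (lightest mu) i.
Definition tree_nxt mu i :=
  memory_of (tree_step (closed_letter i (tree_out mu i)) (tree_of mu)).
Let closed_move := letter_move closed_letter tree_out tree_nxt.
Let closed_edge := [rel v v' | closed_move false v v' || closed_move true v v'].
Let memory0 := memory_of tree0.

Lemma lightestP mu l : covers l (tree_of mu) ->
  covers (lightest mu) (tree_of mu) /\ weight (tree_of mu) (lightest mu) <= weight (tree_of mu) l.
Proof.
move=> cover_l; rewrite /lightest; case: pickP => [l1 cover_l1|/(_ l)]; last by rewrite cover_l.
by case: arg_minnP => // l2 cover_l2 minl2; split=> //; apply: minl2.
Qed.

Lemma closed_letter_rank l i q f q' : closed_letter i (out l i) q f q' -> reach l q ->
  reach (nxt l i) q' /\ rho (nxt l i) q' + f <= rho l q.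
Proof.
case/existsP=> q1 /andP[qq1 q1q'] /(eps_connect_rank qq1)[reach_q1 le_q1].
have [reach_q' le_q'] := letter_rank win q1q' reach_q1.
by split=> //; apply: leq_trans le_q1.
Qed.

Lemma covers_step l T i : covers l T ->
  covers (nxt l i) (tree_step (closed_letter i (out l i)) T).
Proof.
move=> /forallP cover_l; apply/forallP => q'; apply/implyP.
case/active_step_predecessor=> q [f [active_q qq']].
by have /implyP/(_ active_q) := cover_l q; case/(closed_letter_rank qq').
Qed.

Section ClosedPath.
Variables (p : nat -> tree_memory * Q) (i : nat -> In) (f : nat -> bool).
Hypotheses (init_p : initial init memory0 (p 0)) (accepting : infinitely_often (fun n => f n)).
Hypothesis memS : forall n, (p n.+1).1 = tree_nxt (p n).1 (i n).
Hypothesis stateS : forall n,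
  closed_letter (i n) (tree_out (p n).1 (i n)) (p n).2 (f n) (p n.+1).2.
Let T n := tree_of (p n).1.
Let l n := lightest (p n).1.

Lemma closed_path_tree n :
  safra_tree (T n) /\ T n.+1 = tree_step (closed_letter (i n) (out (l n) (i n))) (T n).
Proof.
have stepT n' : safra_tree (T n') ->
    T n'.+1 = tree_step (closed_letter (i n') (out (l n') (i n'))) (T n').
  by move=> tree_n; rewrite /T memS memory_ofK //; apply: tree_step_safra.
suff treeT : safra_tree (T n) by split=> //; apply: stepT.
elim: n => [|n treeT]; last by rewrite stepT // tree_step_safra.
by have /andP[/eqP mem_p0 _] := init_p; rewrite /T mem_p0 memory_ofK safra_tree0.
Qed.

Lemma closed_path_covers n : covers (l n) (T n) /\ covers (nxt (l n) (i n)) (T n.+1).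
Proof.
have coverS n' : covers (l n') (T n') -> covers (nxt (l n') (i n')) (T n'.+1).
  by have [_ ->] := closed_path_tree n'; apply: covers_step.
suff cover_n : covers (l n) (T n) by split=> //; apply: coverS.
elim: n => [|n /coverS/lightestP[]//]; apply: (proj1 (lightestP (l := l0) _)).
have /andP[/eqP -> _] := init_p; rewrite memory_ofK ?safra_tree0 //.
by apply/forallP => q; rewrite active_tree0; apply/implyP/reachable_init.
Qed.

Lemma no_closed_path : False.
Proof.
pose b := (#|L| * #|Q|).+1.
have rho_lt l' q : rho l' q < b by rewrite ltnS -card_prod; apply: rank_max.
have [tree_p0 _] := closed_path_tree 0.
have stepT n := proj2 (closed_path_tree n).
have active0 : active (T 0) (p 0).2.
  have /andP[/eqP mem_p0 init_q0] := init_p.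
  by rewrite /T mem_p0 memory_ofK ?safra_tree0 ?active_tree0.
apply: (accepting_run_not_minimised (q := fun n => (p n).2) (rho := fun n => rho (l n)) (b := b)
  (rho' := fun n => rho (nxt (l n) (i n))) tree_p0 stepT active0 stateS accepting) => //.
  move=> n q c q' active_q qq'; have [/forallP/(_ q) cover_q _] := closed_path_covers n.
  by move: cover_q; rewrite active_q => /(closed_letter_rank qq')[].
by move=> n; have [_ /lightestP[]] := closed_path_covers n.
Qed.
End ClosedPath.

Lemma no_closed_lasso : ~ lasso (initial init memory0) (closed_move false) (closed_move true).
Proof.
case/lasso_path=> p [init_p edge_p accepting_p].
pose f n := closed_move true (p n) (p n.+1).
have /choice[i iP] n : exists i, ((p n.+1).1 == tree_nxt (p n).1 i) &&
    closed_letter i (tree_out (p n).1 i) (p n).2 (f n) (p n.+1).2.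
  apply/existsP; have := edge_p n; rewrite -/(closed_move (f n) _ _) /f /=.
  by case acc: (closed_move true _ _); rewrite ?orbF.
apply: (@no_closed_path p i f init_p) => // n; first by have /andP[/eqP] := iP n.
by have /andP[] := iP n.
Qed.

Lemma connect_closed v u : connect (move eps letter tree_out tree_nxt) v u ->
  exists2 v', connect closed_edge v v' & v'.1 = u.1 /\ connect eps v'.2 u.2.
Proof.
case/connectP=> s; elim/last_ind: s u => [|s w IHs] u /=.
  by move=> _ ->; exists v; rewrite ?connect0.
rewrite rcons_path last_rcons => /andP[/IHs/(_ erefl)[v' vv' [mem_v' eps_v']] step] ->.
move: step; set u' := last v s in mem_v' eps_v' *.
have close f : letter_move letter tree_out tree_nxt f u' w -> exists2 v'',
    connect closed_edge v v'' & v''.1 = w.1 /\ connect eps v''.2 w.2.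
  case/existsP=> i /andP[mem_w qw]; exists w; rewrite ?connect0 //.
  apply: connect_trans vv' _; apply: connect1.
  suff : closed_move f v' w by case: f {qw} => /= ->; rewrite ?orbT.
  by apply/existsP; exists i; rewrite mem_v' mem_w; apply/existsP; exists u'.2; rewrite eps_v'.
case/orP; last exact: close; case/orP; last exact: close.
case/andP=> /eqP mem_w u'w; exists v' => //; rewrite mem_v' mem_w; split=> //.
by apply: connect_trans eps_v' _; apply: connect1.
Qed.

Lemma tree_strategy_winning : winning init eps letter memory0 tree_out tree_nxt.
Proof.
case=> x [y [z [init_x xy yz zy]]]; apply: no_closed_lasso.
have to_z v : v.1 = y.1 -> connect eps v.2 y.2 -> closed_move true v z.
  move=> mem_v eps_v; case/existsP: yz => i /andP[mem_z y_z]; apply/existsP; exists i.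
  by rewrite mem_v mem_z; apply/existsP; exists y.2; rewrite eps_v.
have [y1 xy1 [mem_y1 eps_y1]] := connect_closed xy.
have [y2 zy2 [mem_y2 eps_y2]] := connect_closed zy.
exists x, y2, z; split=> //; last exact: to_z.
apply: connect_trans xy1 _; apply: connect_trans zy2; apply: connect1.
by rewrite /= (to_z y1) ?orbT.
Qed.
End Reduction.

Definition memory_bound n := (2 ^ n) ^ n.

Theorem bounded_progress_measure (L : finType) (l0 : L) (out : L -> In -> Out) (nxt : L -> In -> L)
    (N := memory_bound #|Q|) :
  winning init eps letter l0 out nxt ->
  exists (p0 : 'I_N) rk, progress_measure init eps letter p0 rk /\
    forall p q, rk p q <= (N * #|Q|).+1.
Proof.
move=> /tree_strategy_winning/winning_progress_measure[rk [rk_init rk_eps rk_letter] rk_le].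
have card_memory : #|{: tree_memory}| = N.
  by rewrite card_ffun card_ord -cardsT -powersetT card_powerset cardsT.
pose mem (p : 'I_N) : tree_memory := enum_val (cast_ord (esym card_memory) p).
pose idx (mu : tree_memory) : 'I_N := cast_ord card_memory (enum_rank mu).
have idxK mu : mem (idx mu) = mu by rewrite /mem /idx cast_ordK enum_rankK.
exists (idx (memory_of tree0)), (fun p => rk (mem p)).
split; last by move=> p q; rewrite -[X in X * _]card_memory.
split=> [q|p|p i]; first by rewrite idxK; apply: rk_init.
  exact: rk_eps.
by have [o [mu mu_drop]] := rk_letter (mem p) i; exists o, (idx mu); rewrite idxK.
Qed.
End BoundedMemory.

(** * Computable functions and decidable predicates *)

Definition cfst n := (Cantor.of_nat n).1.
Definition csnd n := (Cantor.of_nat n).2.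

Lemma cpair_to_nat a b : cpair a b = Cantor.to_nat (a, b).
Proof.
have even_prod : odd ((a + b) * (a + b).+1) = false by rewrite oddM /= andbN.
have := odd_double_half ((a + b) * (a + b).+1); rewrite even_prod.
by have := Cantor.to_nat_spec a b; rewrite /cpair; lia.
Qed.

Lemma cfst_cpair a b : cfst (cpair a b) = a.
Proof. by rewrite /cfst cpair_to_nat Cantor.cancel_of_to. Qed.

Lemma csnd_cpair a b : csnd (cpair a b) = b.
Proof. by rewrite /csnd cpair_to_nat Cantor.cancel_of_to. Qed.

Definition unpairE := (cfst_cpair, csnd_cpair).

Lemma cpairK n : cpair (cfst n) (csnd n) = n.
Proof. by rewrite cpair_to_nat -surjective_pairing Cantor.cancel_to_of. Qed.

Lemma cpair_inj a b a' b' : cpair a b = cpair a' b' -> a = a' /\ b = b'.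
Proof. by move=> eq_pair; rewrite -(cfst_cpair a b) -{2}(csnd_cpair a b) eq_pair !unpairE. Qed.

Lemma leq_cpair a b : a <= cpair a b /\ b <= cpair a b.
Proof. by have := Cantor.to_nat_non_decreasing a b; rewrite cpair_to_nat; lia. Qed.

Lemma cpair_leq a b n : cpair a b <= n -> a <= n /\ b <= n.
Proof. by have := leq_cpair a b; lia. Qed.

Lemma ltn_csnd n : 0 < cfst n -> csnd n < n.
Proof.
rewrite -{3}(cpairK n) cpair_to_nat.
by have := Cantor.to_nat_spec (cfst n) (csnd n); nia.
Qed.

Definition computable (f : nat -> nat) := exists c, forall n, eval c n (f n).
Definition decidable_pred (P : nat -> Prop) := computable (fun n => `[< P n >]).

Lemma eq_computable f g : f =1 g -> computable f -> computable g.
Proof. by move=> fg [c cP]; exists c => n; rewrite -fg. Qed.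

Lemma computable_comp h f : computable h -> computable f -> computable (fun z => h (f z)).
Proof. by move=> [c cP] [d dP]; exists (CComp c d) => n; econstructor. Qed.

Create HintDb computable.
#[local] Hint Constants Opaque : computable.
#[local] Hint Variables Opaque : computable.
(* The search depth of eauto counts the steps of the whole derivation. *)
Ltac computability := by eauto 20000 with computable.

Lemma computable_cpair f g :
  computable f -> computable g -> computable (fun z => cpair (f z) (g z)).
Proof. by move=> [c cP] [d dP]; exists (CPair c d) => n; constructor. Qed.
#[local] Hint Resolve computable_cpair : computable.

Lemma computable_cfst f : computable f -> computable (fun z => cfst (f z)).
Proof. by apply: computable_comp; exists CFst => n; rewrite -{1}(cpairK n); constructor. Qed.
#[local] Hint Resolve computable_cfst : computable.

Lemma computable_csnd f : computable f -> computable (fun z => csnd (f z)).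
Proof. by apply: computable_comp; exists CSnd => n; rewrite -{1}(cpairK n); constructor. Qed.
#[local] Hint Resolve computable_csnd : computable.

Lemma computable_id : computable (fun z => z).
Proof. by exists (CPair CFst CSnd) => n; rewrite -(cpairK n); do 2 constructor. Qed.
#[local] Hint Resolve computable_id : computable.

Lemma computable_succ f : computable f -> computable (fun z => (f z).+1).
Proof. by apply: computable_comp; exists CSucc => n; constructor. Qed.
#[local] Hint Resolve computable_succ : computable.

Lemma computable_const a : computable (fun _ => a).
Proof. by elim: a => [|a]; [exists CZero => n; constructor|apply: computable_succ]. Qed.
#[local] Hint Resolve computable_const : computable.

Fixpoint primrec (a : nat) (g : nat -> nat -> nat) (n : nat) : nat :=
  if n is n'.+1 then g n' (primrec a g n') else a.

Lemma computable_primrec f (g : nat -> nat -> nat -> nat) h :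
  computable f -> computable (fun z => g (cfst z) (cfst (csnd z)) (csnd (csnd z))) ->
  computable h -> computable (fun z => primrec (f z) (g z) (h z)).
Proof.
move=> [c cP] [d dP] comp_h.
have rec_pair : computable (fun z => primrec (f (cfst z)) (g (cfst z)) (csnd z)).
  exists (CRec c d) => z; rewrite -{1}(cpairK z).
  elim: (csnd z) => [|n IHn]; first by constructor.
  econstructor; first exact: IHn.
  have := dP (cpair (cfst z) (cpair n (primrec (f (cfst z)) (g (cfst z)) n))).
  by rewrite !unpairE.
apply: eq_computable (computable_comp rec_pair (computable_cpair computable_id comp_h)) => n.
by rewrite !unpairE.
Qed.
#[local] Hint Resolve computable_primrec : computable.

Lemma computable_pred f : computable f -> computable (fun z => (f z).-1).
Proof.
move=> comp_f; apply: (@eq_computable (fun z => primrec 0 (fun n _ => n) (f z))) => [z|].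
  by case: (f z).
computability.
Qed.
#[local] Hint Resolve computable_pred : computable.

Lemma computable_iter h f g : computable h -> computable f -> computable g ->
  computable (fun z => iter (f z) h (g z)).
Proof.
move=> comp_h comp_f comp_g.
apply: (@eq_computable (fun z => primrec (g z) (fun _ => h) (f z))) => [z|].
  by elim: (f z) => //= n ->.
have := computable_comp comp_h; computability.
Qed.
#[local] Hint Resolve computable_iter : computable.

Lemma computable_add f g : computable f -> computable g -> computable (fun z => f z + g z).
Proof.
move=> comp_f comp_g; apply: (@eq_computable (fun z => iter (g z) S (f z))) => [z|].
  by rewrite iter_succn addnC.
computability.
Qed.
#[local] Hint Resolve computable_add : computable.

Lemma computable_sub f g : computable f -> computable g -> computable (fun z => f z - g z).
Proof.
move=> comp_f comp_g; apply: (@eq_computable (fun z => iter (g z) predn (f z))) => [z|].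
  by rewrite iter_predn.
computability.
Qed.
#[local] Hint Resolve computable_sub : computable.

Lemma computable_mul f g : computable f -> computable g -> computable (fun z => f z * g z).
Proof.
move=> comp_f comp_g.
apply: (@eq_computable (fun z => primrec 0 (fun _ => addn (f z)) (g z))) => [z|].
  by rewrite mulnC; elim: (g z) => //= n ->; rewrite mulSn.
have := computable_comp comp_f; computability.
Qed.
#[local] Hint Resolve computable_mul : computable.

Lemma computable_expn f g : computable f -> computable g -> computable (fun z => f z ^ g z).
Proof.
move=> comp_f comp_g.
apply: (@eq_computable (fun z => primrec 1 (fun _ => muln (f z)) (g z))) => [z|].
  by elim: (g z) => //= n ->; rewrite expnS.
have := computable_comp comp_f; computability.
Qed.
#[local] Hint Resolve computable_expn : computable.

Lemma eq_decidable P P' : (forall n, P n <-> P' n) -> decidable_pred P -> decidable_pred P'.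
Proof. by move=> PP'; apply: eq_computable => n; rewrite (asbool_equiv_eq (PP' n)). Qed.

Lemma decidable_const (P : Prop) : decidable_pred (fun _ => P).
Proof. exact: computable_const. Qed.
#[local] Hint Resolve decidable_const : computable.

Lemma decidable_not P : decidable_pred P -> decidable_pred (fun z => ~ P z).
Proof.
rewrite /decidable_pred => decP; apply: (@eq_computable (fun z => 1 - `[< P z >])) => [z|].
  by rewrite asbool_neg; case: `[< P z >].
computability.
Qed.
#[local] Hint Resolve decidable_not : computable.

Lemma decidable_and P P' :
  decidable_pred P -> decidable_pred P' -> decidable_pred (fun z => P z /\ P' z).
Proof.
rewrite /decidable_pred => decP decP'.
apply: (@eq_computable (fun z => `[< P z >] * `[< P' z >])) => [z|].
  by rewrite asbool_and mulnb.
computability.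
Qed.
#[local] Hint Resolve decidable_and : computable.

Lemma decidable_or P P' :
  decidable_pred P -> decidable_pred P' -> decidable_pred (fun z => P z \/ P' z).
Proof.
move=> decP decP'; apply: (@eq_decidable (fun z => ~ (~ P z /\ ~ P' z))) => [n|]; first by tauto.
computability.
Qed.
#[local] Hint Resolve decidable_or : computable.

Lemma decidable_imply P P' :
  decidable_pred P -> decidable_pred P' -> decidable_pred (fun z => P z -> P' z).
Proof.
move=> decP decP'; apply: (@eq_decidable (fun z => ~ P z \/ P' z)) => [n|]; first by tauto.
computability.
Qed.
#[local] Hint Resolve decidable_imply : computable.

Lemma decidable_iff P P' :
  decidable_pred P -> decidable_pred P' -> decidable_pred (fun z => P z <-> P' z).
Proof. by move=> decP decP'; rewrite /iff; computability. Qed.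
#[local] Hint Resolve decidable_iff : computable.

Lemma decidable_leq f g : computable f -> computable g -> decidable_pred (fun z => f z <= g z).
Proof.
move=> comp_f comp_g; apply: (@eq_computable (fun z => 1 - (f z - g z))) => [z|].
  by rewrite asboolb; case: leqP; lia.
computability.
Qed.
#[local] Hint Resolve decidable_leq : computable.

Lemma decidable_eq f g : computable f -> computable g -> decidable_pred (fun z => f z = g z).
Proof.
move=> comp_f comp_g; apply: (@eq_decidable (fun z => f z <= g z /\ g z <= f z)) => [n|].
  by lia.
computability.
Qed.
#[local] Hint Resolve decidable_eq : computable.

Lemma decidable_forall B (P : nat -> nat -> Prop) : computable B ->
  decidable_pred (fun z => P (cfst z) (csnd z)) ->
  decidable_pred (fun z => forall i, i < B z -> P z i).
Proof.
move=> comp_B /computable_comp decP; pose holds_at z i : nat := `[< P z i >].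
apply: (@eq_computable (fun z => primrec 1 (fun i => muln (holds_at z i)) (B z))) => [z|].
  elim: (B z) => [|b IHb] /=; first by rewrite asboolT.
  rewrite IHb mulnb -asbool_and; congr nat_of_bool; apply: asbool_equiv_eq.
  split=> [[Pb allP] i|allP]; last by split=> [|i ib]; apply: allP => //; apply: leqW.
  by rewrite ltnS leq_eqVlt => /predU1P[->//|]; apply: allP.
have comp_holds : computable (fun z => holds_at (cfst z) (cfst (csnd z))).
  have := decP (fun z => cpair (cfst z) (cfst (csnd z))) ltac:(computability).
  by apply: eq_computable => z; rewrite !unpairE.
computability.
Qed.
#[local] Hint Resolve decidable_forall : computable.

Lemma decidable_exists B (P : nat -> nat -> Prop) : computable B ->
  decidable_pred (fun z => P (cfst z) (csnd z)) ->
  decidable_pred (fun z => exists i, i < B z /\ P z i).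
Proof.
move=> comp_B decP; apply: (@eq_decidable (fun z => ~ forall i, i < B z -> ~ P z i)) => [z|].
  split=> [/existsNP[i /not_implyP[iB /contrapT Pi]]|[i [iB Pi]] none]; first by exists i.
  exact: none iB Pi.
computability.
Qed.
#[local] Hint Resolve decidable_exists : computable.

Lemma computable_graph f : decidable_pred (fun z => f (cfst z) = csnd z) -> computable f.
Proof.
case/decidable_not=> c cP; exists (CMu c) => n.
have graphP i : eval c (cpair n i) `[< f n <> i >] by have := cP (cpair n i); rewrite !unpairE.
constructor=> [|i i_lt]; first by have := graphP (f n); rewrite asboolF //; apply.
by exists 1; split=> //; have := graphP i; rewrite asboolT //; lia.
Qed.

Lemma computable_div f g : computable f -> computable g -> computable (fun z => f z %/ g z).
Proof.
move=> comp_f comp_g; apply: computable_graph.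
have := computable_comp comp_f; have := computable_comp comp_g => comp_gg comp_ff.
pose P z := (g (cfst z) = 0 /\ csnd z = 0) \/
  (csnd z * g (cfst z) <= f (cfst z) /\ f (cfst z) < (csnd z).+1 * g (cfst z)).
apply: (@eq_decidable P) => [z|]; last by rewrite /P; computability.
rewrite /P; move: (f _) (g _) (csnd z) => a b q.
case: (posnP b) => [->|b_gt0]; first by rewrite divn0 !muln0 ltn0; intuition.
rewrite -ltn_divLR // -leq_divRL //; lia.
Qed.
#[local] Hint Resolve computable_div : computable.

Lemma computable_mod f g : computable f -> computable g -> computable (fun z => f z %% g z).
Proof.
move=> comp_f comp_g; apply: (@eq_computable (fun z => f z - f z %/ g z * g z)) => [z|].
  by rewrite {1}(divn_eq (f z) (g z)) addKn.
computability.
Qed.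
#[local] Hint Resolve computable_mod : computable.

Lemma computably_decidable_enc (X : Type) (enc : X -> nat) (P : X -> Prop) (P' : nat -> Prop) :
  decidable_pred P' -> (forall x, P x <-> P' (enc x)) -> computably_decidable enc P.
Proof.
move=> [c cP] PP'; exists c => x; have := cP (enc x); rewrite -(asbool_equiv_eq (PP' x)).
by move=> eval_x; split=> [/asboolT|/asboolF] Px; rewrite Px in eval_x.
Qed.

Definition digit (b y i : nat) : nat := (y %/ b ^ i) %% b.

Lemma computable_digit f g h : computable f -> computable g -> computable h ->
  computable (fun z => digit (f z) (g z) (h z)).
Proof. by rewrite /digit => *; computability. Qed.
#[local] Hint Resolve computable_digit : computable.

Lemma digit_lt b y i : 0 < b -> digit b y i < b.
Proof. by move=> b_gt0; rewrite ltn_mod. Qed.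

Lemma digit0 b i : digit b 0 i = 0.
Proof. by rewrite /digit div0n mod0n. Qed.

Lemma digits_exist b n (g : nat -> nat) : 0 < b -> (forall i, i < n -> g i < b) ->
  exists y, y < b ^ n /\ forall i, i < n -> digit b y i = g i.
Proof.
move=> b_gt0; elim: n => [|n IHn] g_lt; first by exists 0.
have [|y [y_lt digit_y]] := IHn; first by move=> i ni; apply: g_lt; apply: leqW.
have bn_gt0 : 0 < b ^ n by rewrite expn_gt0 b_gt0.
exists (g n * b ^ n + y); split; first by rewrite expnS; have := g_lt n (ltnSn n); nia.
move=> i; rewrite ltnS leq_eqVlt => /predU1P[->|i_n].
  by rewrite /digit divnMDl // divn_small // addn0 modn_small // g_lt.
have bi_gt0 : 0 < b ^ i by rewrite expn_gt0 b_gt0.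
have shift : g n * b ^ n = (g n * b ^ (n - i.+1) * b) * b ^ i.
  by rewrite -{2}(subnK i_n) expnD expnS !mulnA.
by rewrite -(digit_y i i_n) /digit shift divnMDl // modnMDl.
Qed.

Lemma subset_code_exists k (Y : {set 'I_k}) :
  exists y : 'I_(2 ^ k), forall i : 'I_k, digit 2 y i = (i \in Y).
Proof.
have [i ik|y [y_lt yE]] :=
    @digits_exist 2 k (fun i => if insub i is Some o then (o : 'I_k) \in Y else false) isT.
  by case: insub => // o; case: (_ \in _).
by exists (Ordinal y_lt) => i; rewrite /= yE ?ltn_ord // valK.
Qed.

Lemma radix_inj b c d c' d' : d < b -> d' < b -> c * b + d = c' * b + d' -> c = c' /\ d = d'.
Proof.
move=> db d'b eq_cd; have c_c' : c = c' by case: (ltngtP c c') => // ?; nia.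
by split=> //; move: eq_cd; rewrite c_c' => /addnI.
Qed.

(** * Clock regions as order types of time stamps *)

Section OrderRank.
Variables (I : finType) (g : I -> R).
Implicit Types i j : I.

Definition order_rank i := #|[set j | `[< (g j < g i)%R >]]|.

Lemma order_rank_lt i : order_rank i < #|I|.
Proof.
rewrite -cardsT; apply: proper_card; apply/properP; split; first exact: subsetT.
by exists i; rewrite ?inE //; apply/asboolP; lra.
Qed.

Lemma ltn_order_rank i j : order_rank i < order_rank j <-> (g i < g j)%R.
Proof.
have leq_rank i1 i2 : (g i1 <= g i2)%R -> order_rank i1 <= order_rank i2.
  move=> le_g; apply/subset_leq_card/subsetP => l.
  by rewrite !inE => /asboolP ?; apply/asboolP; lra.
split=> [|lt_g]; first by case: (Rlt_le_dec (g i) (g j)) => // /leq_rank; rewrite leqNgt => /negP.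
apply: proper_card; apply/properP; split; last by exists i; rewrite inE; apply/asboolP; lra.
by apply/subsetP => l; rewrite !inE => /asboolP ?; apply/asboolP; lra.
Qed.

Lemma exists_max (P : I -> Prop) : (exists i, P i) ->
  exists2 i, P i & forall j, P j -> (g j <= g i)%R.
Proof.
case=> i0 Pi0; have [|i /asboolP Pi maxi] := @arg_maxnP _ i0 (fun i => `[< P i >]) order_rank.
  exact/asboolP.
exists i => // j /asboolP/maxi /=; rewrite leqNgt.
by case: (Rle_lt_dec (g j) (g i)) => // /ltn_order_rank ->.
Qed.
End OrderRank.

Lemma exists_min (I : finType) (g : I -> R) (P : I -> Prop) : (exists i, P i) ->
  exists2 i, P i & forall j, P j -> (g i <= g j)%R.
Proof.
by case/(exists_max (fun i => - g i)%R) => i Pi maxi; exists i => // j /maxi; lra.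
Qed.

Lemma order_preserving_cut (I : finType) (g g' : I -> R) t :
  (forall i j, (g i < g j <-> g' i < g' j)%R) ->
  exists t', forall i, (g i < t <-> g' i < t')%R /\ (t < g i <-> t' < g' i)%R.
Proof.
move=> mono_g; have [[i0 <-]|not_hit] := EM (exists i, g i = t); first by exists (g' i0).
have side i : (g i < t \/ t < g i)%R.
  by case: (Rtotal_order (g i) t) => [|[g_t|]]; [left|case: not_hit; exists i|right].
suff [t' cut] : exists t', forall i, ((g i < t -> g' i < t') /\ (t < g i -> t' < g' i))%R.
  exists t' => i; have [below above] := cut i.
  by case: (side i) => [/[dup] ? /below ?|/[dup] ? /above ?]; split; split=> ?; lra.
have [some_below|none_below] := EM (exists i, (g i < t)%R);
  have [some_above|none_above] := EM (exists i, (t < g i)%R).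
- have [a a_below maxa] := exists_max g' some_below.
  have [b b_above minb] := exists_min g' some_above.
  have ab : (g' a < g' b)%R by apply/mono_g; lra.
  by exists ((g' a + g' b) / 2)%R => i; split=> [/maxa|/minb]; lra.
- have [a _ maxa] := exists_max g' some_below.
  by exists (g' a + 1)%R => i; split=> [/maxa|above]; [lra|case: none_above; exists i].
- have [b _ minb] := exists_min g' some_above.
  by exists (g' b - 1)%R => i; split=> [below|/minb]; [case: none_below; exists i|lra].
- by exists 0%R => i; split=> ?; [case: none_below|case: none_above]; exists i.
Qed.

(* A clock valuation is recorded by time stamps: p 0 is the current time, and the other
   entries are times of last resets, so that clock differences are differences of stamps. *)
Definition stamps_equiv n M (p q : nat -> R) := forall i j, i <= n -> j <= n ->
  forall z, (Z.abs z <= Z.of_nat M)%Z -> ((p i - p j < IZR z)%R <-> (q i - q j < IZR z)%R).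

Definition set_now (p : nat -> R) (t : R) (i : nat) : R := if i is 0 then t else p i.

Definition reset_stamps (rst : nat -> Prop) (p : nat -> R) (i : nat) : R :=
  if i is i'.+1 then if `[< rst i' >] then p 0%N else p i else p 0%N.

Definition past n (p : nat -> R) := forall i, i <= n -> (p i <= p 0%N)%R.

Lemma stamps_equiv_sym n M p q : stamps_equiv n M p q -> stamps_equiv n M q p.
Proof. by move=> pq i j i_n j_n z zM; rewrite pq. Qed.

Lemma stamps_equiv_trans n M p q r :
  stamps_equiv n M p q -> stamps_equiv n M q r -> stamps_equiv n M p r.
Proof. by move=> pq qr i j i_n j_n z zM; rewrite pq // qr. Qed.

Lemma stamps_equivW n M n' M' p q : n' <= n -> M' <= M ->
  stamps_equiv n M p q -> stamps_equiv n' M' p q.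
Proof. by move=> n'n M'M pq i j i_n j_n z zM; apply: pq; lia. Qed.

Lemma stamps_equiv_reindex n M p q p' q' : stamps_equiv n M p q ->
  (forall i, i <= n -> exists2 j, j <= n & p' i = p j /\ q' i = q j) ->
  stamps_equiv n M p' q'.
Proof. by move=> pq idx i j /idx[i' i'n [-> ->]] /idx[j' j'n [-> ->]]; apply: pq. Qed.

Lemma eq_stamps_equiv n M p q p' q' :
  (forall i, i <= n -> p i = p' i) -> (forall i, i <= n -> q i = q' i) ->
  stamps_equiv n M p q -> stamps_equiv n M p' q'.
Proof.
by move=> pp' qq' pq; apply: stamps_equiv_reindex pq _ => i i_n; exists i; rewrite ?pp' ?qq'.
Qed.

Lemma stamps_equiv_reset n M rst p q : stamps_equiv n M p q ->
  stamps_equiv n M (reset_stamps rst p) (reset_stamps rst q).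
Proof.
move=> pq; apply: (stamps_equiv_reindex pq) => -[|i] i_n /=; first by exists 0.
by case: asboolP => _; [exists 0|exists i.+1].
Qed.

Lemma past_equiv n M p q : stamps_equiv n M p q -> past n p -> past n q.
Proof.
move=> pq past_p i i_n; have := pq 0 i isT i_n 0%Z (Zle_0_nat M).
by have := past_p i i_n; lra.
Qed.

Lemma past_set_now n p t : past n p -> (p 0%N <= t)%R -> past n (set_now p t).
Proof. by move=> past_p p_t [|i] /past_p /=; lra. Qed.

Lemma past_reset n rst p : past n p -> past n (reset_stamps rst p).
Proof. by move=> past_p [|i] i_n /=; [lra|case: asboolP => _; [lra|apply: past_p]]. Qed.

Definition cmp_of_lt (c : cmp) (lt gt : Prop) : Prop :=
  match c with CLt => lt | CLe => ~ gt | CEq => ~ lt /\ ~ gt | CGe => ~ lt | CGt => gt end.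

Lemma cmpR_lt c (a b : R) : cmpR c a b <-> cmp_of_lt c (a < b)%R (b < a)%R.
Proof. by case: c => /=; split; lra. Qed.

Lemma stamps_equiv_cmp n M p q c i j z : stamps_equiv n M p q -> i <= n -> j <= n ->
  (Z.abs z <= Z.of_nat M)%Z -> cmpR c (p i - p j) (IZR z) <-> cmpR c (q i - q j) (IZR z).
Proof.
move=> pq i_n j_n zM; have lt_z := pq i j i_n j_n z zM.
have gt_z : ((IZR z < p i - p j)%R <-> (IZR z < q i - q j)%R).
  by have := pq j i j_n i_n (- z)%Z ltac:(lia); rewrite opp_IZR; lra.
by rewrite !cmpR_lt; case: c; rewrite /= ?lt_z ?gt_z.
Qed.

(* A later time has only to be placed among the points p i + z with 0 <= z <= M, whose
   relative order is determined by the equivalence class. *)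
Lemma shifted_stamps_cut n M p q t : stamps_equiv n M p q ->
  exists t', forall i (z : nat), i <= n -> z <= M ->
    ((p i + INR z < t <-> q i + INR z < t') /\ (t < p i + INR z <-> t' < q i + INR z))%R.
Proof.
move=> pq; pose shift (o : nat -> R) (iz : 'I_n.+1 * 'I_M.+1) := (o iz.1 + INR iz.2)%R.
have [|t' cut] := @order_preserving_cut _ (shift p) (shift q) t.
  move=> [i a] [j b]; rewrite /shift /=.
  have := pq i j (ltn_ord i) (ltn_ord j) (Z.of_nat b - Z.of_nat a)%Z.
  have := ltn_ord a; have := ltn_ord b => aM bM /(_ ltac:(lia)).
  by rewrite minus_IZR -!INR_IZR_INZ; lra.
exists t' => i z i_n zM.
exact: cut (Ordinal (i_n : i < n.+1), Ordinal (zM : z < M.+1)).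
Qed.

Lemma elapse_match n M p q t : stamps_equiv n M p q -> past n p -> (p 0%N <= t)%R ->
  exists t', (q 0%N <= t')%R /\ stamps_equiv n M (set_now p t) (set_now q t').
Proof.
move=> pq past_p p_t; have past_q := past_equiv pq past_p.
have [t' cut] := shifted_stamps_cut t pq.
have q_t' : (q 0%N <= t')%R by have := cut 0 0 isT isT; rewrite /=; lra.
have cutZ i z : i <= n -> (Z.abs z <= Z.of_nat M)%Z ->
    ((p i + IZR z < t <-> q i + IZR z < t') /\ (t < p i + IZR z <-> t' < q i + IZR z))%R.
  move=> i_n zM; case: (Z_le_gt_dec 0 z) => z_ge0.
    by have := cut i (Z.to_nat z) i_n ltac:(lia); rewrite INR_IZR_INZ Z2Nat.id.
  have : (IZR z < 0)%R by apply: IZR_lt; lia.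
  by have := past_p i i_n; have := past_q i i_n; lra.
exists t'; split=> // i j i_n j_n z zM.
case: i i_n => [|i] i_n; case: j j_n => [|j] j_n /=.
- lra.
- by have := cutZ j.+1 z j_n zM; lra.
- have := cutZ i.+1 (- z)%Z i_n ltac:(lia); rewrite opp_IZR; lra.
- exact: pq.
Qed.

Section Rounding.
Variables N M : nat.
Implicit Types (p : nat -> R) (i j h : nat).
Let gap := M.+1 * N.

Definition grid_rep p (u : nat -> Z) := forall i j, i < N -> j < N ->
  forall z, (Z.abs z <= Z.of_nat M)%Z ->
    ((p i - p j < IZR z)%R <-> (u i < u j + z * Z.of_nat N)%Z).

(* Integer parts are kept and fractional parts are replaced by their ranks. *)
Lemma int_grid_rep p : exists u, grid_rep p u.
Proof.
pose fl i := Int_part (p i); pose fr i := frac_part (p i).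
have pE i : p i = (IZR (fl i) + fr i)%R by rewrite /fl /fr /frac_part; ring.
have fr_bounds i : (0 <= fr i < 1)%R by have [] := base_fp (p i); rewrite /fr; lra.
pose rk i := if insub i is Some o then order_rank (fun o' : 'I_N => fr o') o else 0.
have rkE i (iN : i < N) : rk i = order_rank (fun o' : 'I_N => fr o') (Ordinal iN).
  by rewrite /rk insubT.
exists (fun i => fl i * Z.of_nat N + Z.of_nat (rk i))%Z => i j iN jN z _.
have rk_mono : rk i < rk j <-> (fr i < fr j)%R by rewrite !rkE ltn_order_rank.
have rkN : rk i < N /\ rk j < N.
  by rewrite !rkE; split; apply: leq_trans (order_rank_lt _ _) _; rewrite card_ord.
rewrite (pE i) (pE j); have := fr_bounds i; have := fr_bounds j => fr_i fr_j.
have [lt_z|[eq_z|gt_z]] : (fl i - fl j < z \/ fl i - fl j = z \/ z < fl i - fl j)%Z by lia.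
- have : (IZR (fl i) - IZR (fl j) + 1 <= IZR z)%R.
    by rewrite -minus_IZR -plus_IZR; apply: IZR_le; lia.
  by split=> _; [nia|lra].
- have -> : ((IZR (fl i) + fr i - (IZR (fl j) + fr j) < IZR z)%R <-> (fr i < fr j)%R).
    by rewrite -eq_z minus_IZR; split; lra.
  by rewrite -rk_mono; nia.
- have : (IZR z + 1 <= IZR (fl i) - IZR (fl j))%R.
    by rewrite -minus_IZR -plus_IZR; apply: IZR_le; lia.
  by split=> ?; [lra|nia].
Qed.

Lemma nat_grid_rep p : exists u : nat -> nat, grid_rep p (fun i => Z.of_nat (u i)).
Proof.
have [u rep_u] := int_grid_rep p.
pose shift := (\sum_(j < N) Z.abs_nat (u j)).
exists (fun i => Z.to_nat (u i + Z.of_nat shift)) => i j iN jN z zM.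
have nonneg l : l < N -> (0 <= u l + Z.of_nat shift)%Z.
  by move=> lN; rewrite /shift (bigD1 (Ordinal lN)) //=; lia.
by rewrite (rep_u i j) // !Z2Nat.id; [lia|apply: nonneg..].
Qed.

Lemma exists_gap (u : nat -> nat) i0 : i0 < N -> N * gap < u i0 ->
  exists h, h < N /\ forall i, i < N -> u i <= h * gap \/ h.+1 * gap < u i.
Proof.
move=> i0N u_big; apply: contrapT => no_gap.
have /choice[occupant occupantP] (h : 'I_N) : exists i : 'I_N, h * gap < u i <= h.+1 * gap.
  apply: contrapT => none; apply: no_gap; exists h; split=> // i iN.
  by case: (leqP (u i) (h * gap)) => ?; [left|right; rewrite ltnNge; apply/negP => ?];
    last by apply: none; exists (Ordinal iN); apply/andP.
have inj : injective occupant.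
  move=> h h' eq_occ; have := occupantP h; have := occupantP h'; rewrite eq_occ => u_h' u_h.
  by apply/val_inj => /=; case: (ltngtP h h') => // lt_h; nia.
have /codomP[h i0E] := injF_onto inj (Ordinal i0N).
by have := occupantP h; rewrite -i0E /=; have := ltn_ord h; nia.
Qed.

(* Lowering by one unit all the values above a gap that is longer than every constant
   does not affect the comparisons. *)
Lemma lower_above_gap p (u : nat -> nat) h : grid_rep p (fun i => Z.of_nat (u i)) ->
  (forall i, i < N -> u i <= h * gap \/ h.+1 * gap < u i) ->
  grid_rep p (fun i => Z.of_nat (if h.+1 * gap < u i then u i - N else u i)).
Proof.
move=> rep_u empty i j iN jN z zM; rewrite rep_u //.
have : (- Z.of_nat (M * N) <= z * Z.of_nat N <= Z.of_nat (M * N))%Z by nia.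
have : h.+1 * gap = h * gap + M * N + N by rewrite /gap; lia.
move: (empty i iN) (empty j jN).
move: (h.+1 * gap) (h * gap) (M * N) (z * Z.of_nat N)%Z => top bottom width d.
by case: ifP; case: ifP; lia.
Qed.

Lemma bounded_grid_rep p : exists u : nat -> nat,
  grid_rep p (fun i => Z.of_nat (u i)) /\ forall i, i < N -> u i <= N * gap.
Proof.
have [u rep_u] := nat_grid_rep p.
have [s] := ubnP (\sum_(i < N) u i); elim: s u rep_u => // s IHs u rep_u sum_u.
have [|/existsNP[i0 /not_implyP[i0N /negP]]] := EM (forall i, i < N -> u i <= N * gap).
  by exists u.
rewrite -ltnNge => u_big; have [h [hN empty]] := exists_gap i0N u_big.
have above : h.+1 * gap < u i0.
  case: (empty i0 i0N) => // u_le; have := leq_trans u_big u_le.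
  by rewrite ltnNge leq_mul2r (ltnW hN) orbT.
have N_le_u : N <= u i0.
  by apply: leq_trans (ltnW above); rewrite /gap mulnA leq_pmull.
apply: (IHs _ (lower_above_gap rep_u empty)); rewrite -ltnS; apply: leq_trans sum_u.
rewrite ltnS (bigD1 (Ordinal i0N)) //= [X in _ < X](bigD1 (Ordinal i0N)) //= above.
rewrite -addSn leq_add //; first by rewrite ltn_subrL; apply/andP; lia.
by apply: leq_sum => i _; case: ifP; rewrite ?leq_subr.
Qed.
End Rounding.

Definition clock_entry k y := k.+1 + y.
Definition sat_stamps k (p : nat -> R) g := sat (fun y => (p 0%N - p (clock_entry k y))%R) g.
Definition stamps_val k (p : nat -> R) (i : 'I_k) : R := (p 0%N - p i.+1)%R.

Lemma eq_sat nu nu' g : nu =1 nu' -> sat nu g <-> sat nu' g.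
Proof.
by move=> eq_nu; elim: g => //= [y c z|y y' c z|g1 IH1|g1 IH1 g2 IH2|g1 IH1 g2 IH2];
  rewrite ?eq_nu; tauto.
Qed.

Lemma sat_equiv K n m M p q (nu nu' : nat -> R) idx g : stamps_equiv n M p q -> m <= M ->
  (forall y, y < K ->
    [/\ idx y <= n, nu y = (p 0%N - p (idx y))%R & nu' y = (q 0%N - q (idx y))%R]) ->
  guard_over K m g -> sat nu g <-> sat nu' g.
Proof.
move=> pq mM vals; have diff_diff (a b d : R) : (a - b - (a - d) = d - b)%R by ring.
elim: g => //= [y c z [yK zm]|y y' c z [yK [y'K zm]]|g1 IH1|g1 IH1 g2 IH2 []|g1 IH1 g2 IH2 []].
- by have [idx_n -> ->] := vals y yK; apply: (stamps_equiv_cmp _ pq); lia.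
- have [idx_n -> ->] := vals y yK; have [idx'_n -> ->] := vals y' y'K.
  by rewrite !diff_diff; apply: (stamps_equiv_cmp _ pq); lia.
- by tauto.
- by tauto.
- by tauto.
Qed.

Lemma sat_stamps_equiv k K n m M p q g : stamps_equiv n M p q -> k + K <= n -> m <= M ->
  guard_over K m g -> sat_stamps k p g <-> sat_stamps k q g.
Proof.
move=> pq K_n mM; apply: (sat_equiv (idx := clock_entry k) pq mM) => y yK.
by split=> //; rewrite /clock_entry; lia.
Qed.

Lemma ext_valE k (nu : 'I_k -> R) y (yk : y < k) : ext_val nu y = nu (Ordinal yk).
Proof.
rewrite /ext_val; case: insubP => [o _ oE|]; last by rewrite yk.
by congr nu; apply: val_inj.
Qed.

Lemma ext_stamps_val k p y : y < k -> ext_val (@stamps_val k p) y = (p 0%N - p y.+1)%R.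
Proof. by move=> yk; rewrite ext_valE. Qed.

Lemma region_equivP k m p q :
  region_equiv m (@stamps_val k p) (@stamps_val k q) <-> stamps_equiv k m p q.
Proof.
split=> [same_region i j i_k j_k z zm|pq g]; last first.
  apply: (sat_equiv (idx := S) pq (leqnn m)) => y yk.
  by split; rewrite ?ext_stamps_val.
have val_lt y c z' : y < k -> (Z.abs z' <= Z.of_nat m)%Z ->
    cmpR c (p 0%N - p y.+1) (IZR z') <-> cmpR c (q 0%N - q y.+1) (IZR z').
  by move=> yk zm'; have := same_region (GAtom y c z') (conj yk zm'); rewrite /= !ext_stamps_val.
case: i i_k => [|i] i_k; case: j j_k => [|j] j_k; first by lra.
- exact: (val_lt j CLt).
- by have := val_lt i CGt (- z)%Z i_k ltac:(lia); rewrite /= opp_IZR; lra.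
- have := same_region (GDiff j i CLt z) (conj j_k (conj i_k zm)); rewrite /= !ext_stamps_val //.
  by lra.
Qed.

(** * Certificates *)

Definition tail_code l := csnd l.-1.
Definition in_code l a : Prop :=
  exists i, i < l /\ (iter i tail_code l <> 0 /\ cfst (iter i tail_code l).-1 = a).

Definition src_code e := cfst e.
Definition label_code e := cfst (csnd e).
Definition guard_code e := cfst (csnd (csnd e)).
Definition resets_code e := cfst (csnd (csnd (csnd e))).
Definition dst_code e := csnd (csnd (csnd (csnd e))).

Definition inputs_code x := cfst x.
Definition outputs_code x := cfst (csnd x).
Definition init_code x := cfst (csnd (csnd x)).
Definition final_code x := cfst (csnd (csnd (csnd x))).
Definition rules_code x := csnd (csnd (csnd (csnd x))).

Section Certificate.
(* x is the code of the instance; it bounds all its clocks, locations and constants.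
   In a vector, entry 0 is the current time, entries 1..k are the last reset times of the
   controller clocks, and entry k+1+y is the last reset time of the clock y. *)
Variables k m x : nat.

Definition nclocks := k + x.+1.
Definition max_const := x + m.
Definition grid := nclocks.+2.
Definition box := grid * (max_const.+1 * grid).
Definition nvectors := box.+1 ^ nclocks.+1.
Definition entry v i := digit box.+1 v i.
Definition nstates := 2 * x.+1 * nvectors.
Definition nmemory := memory_bound nstates.
Definition max_rank := (nmemory * nstates).+2.

Definition compare_code (c a b : nat) : Prop :=
  (c = 0 /\ a < b) \/ (c = 1 /\ a <= b) \/ (c = 2 /\ a = b) \/ (c = 3 /\ b <= a) \/
  (c = 4 /\ b < a).

(* cz is the code of a comparison and an integer; cfst (csnd cz) is 0 for nonnegative integers. *)
Definition diff_code (cz a b : nat) : Prop :=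
  (cfst (csnd cz) = 0 /\ compare_code (cfst cz) a (b + csnd (csnd cz) * grid)) \/
  (cfst (csnd cz) = 1 /\ compare_code (cfst cz) (a + csnd (csnd cz) * grid) b).

Definition left_arg h := cfst (csnd h).
Definition right_arg h := csnd (csnd h).
Definition holds t h := digit 2 t h = 1.
Definition local_sat w t h : Prop :=
  cfst h = 0 \/
  (cfst h = 1 /\ diff_code (right_arg h) (entry w 0) (entry w (clock_entry k (left_arg h)))) \/
  (cfst h = 2 /\ diff_code (csnd (right_arg h))
     (entry w (clock_entry k (cfst (right_arg h)))) (entry w (clock_entry k (left_arg h)))) \/
  (cfst h = 3 /\ ~ holds t (csnd h)) \/
  (cfst h = 4 /\ (holds t (left_arg h) /\ holds t (right_arg h))) \/
  (cfst h = 5 /\ (holds t (left_arg h) \/ holds t (right_arg h))).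

(* The digits of t are the truth values of all (codes of) subguards of g. *)
Definition sat_code g w : Prop :=
  exists t, t < 2 ^ g.+1 /\
    ((forall h, h < g.+1 -> (holds t h <-> local_sat w t h)) /\ holds t g).

Definition equiv_code n M u v : Prop :=
  forall i, i < n.+1 -> forall j, j < n.+1 -> forall z, z < M.+1 ->
    (entry u i < entry u j + z * grid <-> entry v i < entry v j + z * grid) /\
    (entry u i + z * grid < entry u j <-> entry v i + z * grid < entry v j).

Definition reset_code e Y i : Prop :=
  (i < k /\ digit 2 Y i = 1) \/ (k <= i /\ in_code (resets_code e) (i - k)).

Definition elapse_code v w : Prop :=
  (forall i, i < nclocks -> entry w i.+1 = entry v i.+1) /\ entry v 0 <= entry w 0.

Definition update_code e Y w u' : Prop :=
  entry u' 0 = entry w 0 /\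
  (forall i, i < nclocks -> (reset_code e Y i -> entry u' i.+1 = entry w 0) /\
    (~ reset_code e Y i -> entry u' i.+1 = entry w i.+1)).

(* Time can only elapse on some of the vectors that represent a region, hence v. *)
Definition edge_code e Y u w u' : Prop :=
  (exists v, v < nvectors /\ (equiv_code nclocks max_const u v /\ elapse_code v w)) /\
  (sat_code (guard_code e) w /\ update_code e Y w u').

(* The flag tells whether a final location was left since the last letter.  Accepting
   visits are counted once per letter because a cycle of epsilon-rules through a final
   location may be iterated arbitrarily often without accepting anything. *)
Definition flag_code f e f' : Prop := f' = 1 <-> f = 1 \/ in_code (final_code x) (src_code e).

Section Measure.
(* rk p f l u is the rank of the memory state p at flag f, location l and vector u; it is 0
   when they cannot occur together. *)
Variable rk : nat -> nat -> nat -> nat -> nat.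

Definition cert_init : Prop :=
  exists p, p < nmemory /\
    forall l, l < x.+1 -> in_code (init_code x) l -> 0 < rk p 0 l 0.

Definition cert_eps : Prop :=
  forall p, p < nmemory -> forall f, f < 2 -> forall f', f' < 2 ->
  forall e, e < x.+1 -> in_code (rules_code x) e -> label_code e = 0 -> flag_code f e f' ->
  forall u, u < nvectors -> forall w, w < nvectors -> forall u', u' < nvectors ->
  edge_code e 0 u w u' -> 0 < rk p f (src_code e) u ->
  0 < rk p f' (dst_code e) u' /\ rk p f' (dst_code e) u' <= rk p f (src_code e) u.

Definition answer_code p a c b Y p' : Prop :=
  forall f, f < 2 -> forall f', f' < 2 ->
  forall e, e < x.+1 -> in_code (rules_code x) e -> label_code e = (cpair a b).+1 ->
  flag_code f e f' ->
  forall u, u < nvectors -> forall w, w < nvectors -> forall u', u' < nvectors ->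
  edge_code e Y u w u' -> equiv_code k m w c -> 0 < rk p f (src_code e) u ->
  0 < rk p' 0 (dst_code e) u' /\ rk p' 0 (dst_code e) u' + f' <= rk p f (src_code e) u.

Definition cert_letter : Prop :=
  forall p, p < nmemory -> forall a, a < inputs_code x -> forall c, c < nvectors ->
  exists b, b < outputs_code x /\ exists Y, Y < 2 ^ k /\ exists p', p' < nmemory /\
  answer_code p a c b Y p'.

Definition certificate := cert_init /\ cert_eps /\ cert_letter.
End Measure.

Definition state_index p f l u := ((p * 2 + f) * x.+1 + l) * nvectors + u.
Definition table y p f l u := digit max_rank y (state_index p f l u).
Definition has_certificate :=
  exists y, y < max_rank ^ (nmemory * nstates) /\ certificate (table y).
End Certificate.

Lemma state_index_inj k m x p f l u p' f' l' u' :
  f < 2 -> f' < 2 -> l < x.+1 -> l' < x.+1 -> u < nvectors k m x -> u' < nvectors k m x ->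
  state_index k m x p f l u = state_index k m x p' f' l' u' -> [/\ p = p', f = f', l = l' & u = u'].
Proof.
move=> f_lt f'_lt l_lt l'_lt u_lt u'_lt.
by case/(radix_inj u_lt u'_lt)=> /(radix_inj l_lt l'_lt)[/(radix_inj f_lt f'_lt)[]].
Qed.

Lemma state_index_lt k m x p f l u : p < nmemory k m x -> f < 2 -> l < x.+1 ->
  u < nvectors k m x -> state_index k m x p f l u < nmemory k m x * nstates k m x.
Proof.
rewrite /state_index /nstates => p_lt f_lt l_lt u_lt.
have pf_lt : p * 2 + f < nmemory k m x * 2 by lia.
have pfl_lt : (p * 2 + f) * x.+1 + l < nmemory k m x * 2 * x.+1 by nia.
by nia.
Qed.

#[local] Hint Unfold clock_entry tail_code in_code src_code label_code guard_code resets_code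
  dst_code inputs_code outputs_code init_code final_code rules_code nclocks max_const grid box
  nvectors entry nstates memory_bound nmemory max_rank compare_code diff_code left_arg right_arg
  holds local_sat sat_code equiv_code reset_code elapse_code update_code edge_code flag_code
  cert_init cert_eps answer_code cert_letter certificate state_index table has_certificate
  : computable.

Lemma decidable_has_certificate k m : decidable_pred (has_certificate k m).
Proof. by autounfold with computable; computability. Qed.

(** * Codes and their meaning *)

Lemma leq_size_enc_seq (X : Type) (enc : X -> nat) s : size s <= enc_seq enc s.
Proof.
elim: s => //= y s IHs; rewrite ltnS; apply: leq_trans IHs _.
by have [] := leq_cpair (enc y) (enc_seq enc s).
Qed.

Lemma leq_enc_seq (X : Type) (enc : X -> nat) s y : List.In y s -> enc y <= enc_seq enc s.
Proof.
elim: s => //= y' s IHs; have [le_head le_tail] := leq_cpair (enc y') (enc_seq enc s).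
by case=> [<-|/IHs le_y]; apply: leqW; [|apply: leq_trans le_tail].
Qed.

Lemma iter_tail_code (X : Type) (enc : X -> nat) s i :
  iter i tail_code (enc_seq enc s) = enc_seq enc (drop i s).
Proof.
elim: i s => [|i IHi] s; first by rewrite drop0.
rewrite iterSr; case: s => [|y s] /=; last by rewrite /tail_code /= csnd_cpair IHi.
by rewrite -[tail_code 0]/(enc_seq enc [::]) IHi.
Qed.

Lemma in_codeP (X : Type) (enc : X -> nat) s a :
  in_code (enc_seq enc s) a <-> exists y, List.In y s /\ enc y = a.
Proof.
split=> [[i [_ []]]|[y [y_s <-]]].
  rewrite iter_tail_code; have := cat_take_drop i s; case: (drop i s) => //= y s' <- _.
  by rewrite cfst_cpair => <-; exists y; split=> //; apply/List.in_or_app; right; left.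
have [s1 [s2 sE]] := List.in_split _ _ y_s; exists (size s1).
have drop_s : drop (size s1) s = y :: s2 by rewrite sE drop_size_cat.
split; last by rewrite iter_tail_code drop_s /= cfst_cpair.
apply: leq_trans (leq_size_enc_seq enc s).
by rewrite sE size_cat /= addnS ltnS leq_addr.
Qed.

Lemma List_In_mem (T : eqType) (y : T) s : List.In y s <-> y \in s.
Proof.
elim: s => //= y' s IHs; rewrite in_cons; split=> [[->|/IHs->]|/predU1P[->|/IHs]].
- by rewrite eqxx.
- by rewrite orbT.
- by left.
- by right.
Qed.

Lemma in_code_id s a : in_code (enc_seq id s) a <-> a \in s.
Proof.
by rewrite in_codeP -List_In_mem; split=> [[y [y_s <-]]//|a_s]; exists a.
Qed.

Lemma abs_enc_Z z n : enc_Z z <= n -> (Z.abs z <= Z.of_nat n)%Z.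
Proof.
by rewrite /enc_Z; case: (Z.leb_spec 0 z) => z_sign /cpair_leq[_]; lia.
Qed.

Lemma enc_guard_over g n : enc_guard g <= n -> guard_over n.+1 n g.
Proof.
elim: g => //= [y c z|y y' c z|g IHg|g1 IH1 g2 IH2|g1 IH1 g2 IH2] /cpair_leq[_].
- by case/cpair_leq=> y_n /cpair_leq[_ /abs_enc_Z].
- by case/cpair_leq=> y_n /cpair_leq[y'_n /cpair_leq[_ /abs_enc_Z]].
- exact: IHg.
- by case/cpair_leq=> /IH1 ? /IH2.
- by case/cpair_leq=> /IH1 ? /IH2.
Qed.

Lemma rule_codeE r :
  (src_code (enc_rule r) = r_src r) * (label_code (enc_rule r) = enc_lab (r_lab r)) *
  (guard_code (enc_rule r) = enc_guard (r_guard r)) *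
  (resets_code (enc_rule r) = enc_seq id (r_reset r)) * (dst_code (enc_rule r) = r_dst r).
Proof.
by rewrite /src_code /label_code /guard_code /resets_code /dst_code /enc_rule !unpairE.
Qed.

Lemma instance_codeE I :
  (inputs_code (enc_instance I) = i_nA I) * (outputs_code (enc_instance I) = i_nB I) *
  (init_code (enc_instance I) = enc_seq id (ta_init (i_ta I))) *
  (final_code (enc_instance I) = enc_seq id (ta_final (i_ta I))) *
  (rules_code (enc_instance I) = enc_seq enc_rule (ta_rules (i_ta I))).
Proof.
rewrite /inputs_code /outputs_code /init_code /final_code /rules_code.
by rewrite /enc_instance /enc_TA !unpairE.
Qed.

Lemma instance_bound I : enc_seq id (ta_init (i_ta I)) <= enc_instance I /\
  enc_seq enc_rule (ta_rules (i_ta I)) <= enc_instance I.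
Proof.
by have /cpair_leq[_ /cpair_leq[_ /cpair_leq[? /cpair_leq[]]]] := leqnn (enc_instance I).
Qed.

Lemma rule_bound I r : List.In r (ta_rules (i_ta I)) ->
  [/\ enc_rule r <= enc_instance I, r_src r <= enc_instance I,
      enc_guard (r_guard r) <= enc_instance I & r_dst r <= enc_instance I].
Proof.
move/(leq_enc_seq enc_rule)/leq_trans/(_ (proj2 (instance_bound I))) => r_bound.
by have /cpair_leq[? /cpair_leq[_ /cpair_leq[? /cpair_leq[_ ?]]]] := r_bound.
Qed.

Lemma init_bound I l : l \in ta_init (i_ta I) -> l <= enc_instance I.
Proof.
move/List_In_mem/(leq_enc_seq id)/leq_trans; apply; exact: (proj1 (instance_bound I)).
Qed.

Lemma rule_in_code I r : List.In r (ta_rules (i_ta I)) ->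
  in_code (rules_code (enc_instance I)) (enc_rule r).
Proof. by rewrite instance_codeE in_codeP; exists r. Qed.

Lemma flag_codeP I r (b b' : bool) : flag_code (enc_instance I) b (enc_rule r) b' <->
  b' = b || (r_src r \in ta_final (i_ta I)).
Proof.
rewrite /flag_code instance_codeE rule_codeE in_code_id; move: (_ \in _) => d.
by case: b; case: b'; case: d; lia.
Qed.

Section Grid.
Variables k m x : nat.
Let n := nclocks k x.
Let M := max_const m x.
Let G := grid k x.
Notation entry := (entry k m x).

Definition grid_stamps v i : R := (INR (entry v i) / INR G)%R.

Definition represents v p := stamps_equiv n M (grid_stamps v) p.

Lemma grid_gt0 : (0 < INR G)%R.
Proof. by apply: lt_0_INR; apply/ltP. Qed.

Lemma grid_diff_lt a b z : (INR a / INR G - INR b / INR G < IZR z)%R <->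
  (Z.of_nat a < Z.of_nat b + z * Z.of_nat G)%Z.
Proof.
have G_gt0 := grid_gt0.
have scale c : INR c = (INR c / INR G * INR G)%R by field; lra.
have -> : (Z.of_nat a < Z.of_nat b + z * Z.of_nat G)%Z <-> (INR a < INR b + IZR z * INR G)%R.
  by rewrite !INR_IZR_INZ -mult_IZR -plus_IZR; split=> [/IZR_lt|/lt_IZR].
by rewrite {2}(scale a) {2}(scale b); split; nra.
Qed.

Lemma compare_codeP c a b : compare_code (enc_cmp c) a b <-> cmp_of_lt c (a < b) (b < a).
Proof. by case: c; rewrite /compare_code /=; lia. Qed.

Lemma diff_codeP c z a b : diff_code k x (cpair (enc_cmp c) (enc_Z z)) a b <->
  cmpR c (INR a / INR G - INR b / INR G) (IZR z).
Proof.
have gt_z : (IZR z < INR a / INR G - INR b / INR G)%R <->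
    (Z.of_nat b + z * Z.of_nat G < Z.of_nat a)%Z.
  have [to_Z of_Z] := grid_diff_lt b a (- z); rewrite opp_IZR in to_Z of_Z.
  by split=> gt; [have := to_Z ltac:(lra); lia|have := of_Z ltac:(lia); lra].
rewrite cmpR_lt (propext (grid_diff_lt a b z)) (propext gt_z) /diff_code !unpairE /enc_Z.
case: (Z.leb_spec 0 z) => z_sign; rewrite !unpairE compare_codeP -/G.
  have <- : Z.of_nat (Z.to_nat z * G) = (z * Z.of_nat G)%Z by nia.
  by move: (_ * G) => zG; case: c => /=; lia.
have -> : (z * Z.of_nat G = - Z.of_nat (Z.to_nat (- z) * G))%Z by nia.
by rewrite compare_codeP; move: (_ * G) => zG; case: c => /=; lia.
Qed.

Lemma equiv_codeP n' M' u v :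
  equiv_code k m x n' M' u v <-> stamps_equiv n' M' (grid_stamps u) (grid_stamps v).
Proof.
split=> [uv i j i_n j_n z zM|uv i i_n j j_n z zM]; rewrite /grid_stamps.
  rewrite !grid_diff_lt; have := uv i i_n j j_n (Z.abs_nat z) ltac:(lia); rewrite -/G.
  by case: (Z_lt_le_dec z 0); nia.
have := uv i j i_n j_n (Z.of_nat z) ltac:(lia); have := uv i j i_n j_n (- Z.of_nat z)%Z ltac:(lia).
by rewrite /grid_stamps !grid_diff_lt -/G; split; nia.
Qed.

Lemma eq_local_sat w t t' h : (forall h', h' < h -> (holds t h' <-> holds t' h')) ->
  local_sat k m x w t h <-> local_sat k m x w t' h.
Proof.
move=> eq_t; rewrite /local_sat; case: (posnP (cfst h)) => [->|tag_gt0]; first by intuition.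
have args_lt := ltn_csnd tag_gt0.
have [left_le right_le] : left_arg h <= csnd h /\ right_arg h <= csnd h.
  by apply: cpair_leq; rewrite cpairK.
by rewrite !eq_t //; [apply: leq_ltn_trans args_lt..].
Qed.

Lemma truth_table_exists w l :
  exists t, t < 2 ^ l /\ forall h, h < l -> (holds t h <-> local_sat k m x w t h).
Proof.
elim: l => [|l [t [t_lt tP]]]; first by exists 0.
have [|t' [t'_lt t'_digit]] :=
    @digits_exist 2 l.+1 (fun h => if h < l then digit 2 t h else `[< local_sat k m x w t l >]) isT.
  by move=> h _; case: ifP => _; [rewrite digit_lt|case: asboolP].
have same h : h < l -> (holds t h <-> holds t' h).
  by rewrite /holds => hl; rewrite t'_digit ?hl // leqW.
exists t'; split=> // h; rewrite ltnS leq_eqVlt => /predU1P[->|hl].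
  rewrite -(eq_local_sat w same) /holds t'_digit // ltnn.
  by case: asboolP; intuition.
by rewrite -same // tP //; apply: eq_local_sat => h' h'h; apply: same (ltn_trans h'h hl).
Qed.

Lemma holds_enc_guard t w l g :
  (forall h, h < l -> (holds t h <-> local_sat k m x w t h)) -> enc_guard g < l ->
  holds t (enc_guard g) <-> sat_stamps k (grid_stamps w) g.
Proof.
move=> tP; have sub a b : cpair a b < l -> a < l /\ b < l by case: (leq_cpair a b); lia.
have diff_diff (a b d : R) : (a - b - (a - d) = d - b)%R by ring.
elim: g => [|y c z|y y' c z|g IHg|g1 IH1 g2 IH2|g1 IH1 g2 IH2] g_lt;
  rewrite tP // /local_sat /left_arg /right_arg /= !unpairE /sat_stamps /=;
  move: (g_lt) => /= /sub[_].
- by move=> _; split=> // _; left.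
- by move=> _; rewrite diff_codeP; intuition discriminate.
- by move=> _; rewrite diff_codeP diff_diff; intuition discriminate.
- by move=> /IHg; rewrite /sat_stamps => <-; intuition discriminate.
- case/sub=> /IH1 sat1 /IH2; rewrite /sat_stamps in sat1 * => <-; rewrite -sat1.
  by intuition discriminate.
- case/sub=> /IH1 sat1 /IH2; rewrite /sat_stamps in sat1 * => <-; rewrite -sat1.
  by intuition discriminate.
Qed.

Lemma represents0 : represents 0 (fun=> 0%R).
Proof.
apply: eq_stamps_equiv (fun _ _ _ _ _ _ => iff_refl _) => i _ //.
by rewrite /grid_stamps /entry digit0 /Rdiv Rmult_0_l.
Qed.

Lemma sat_codeP g w : sat_code k m x (enc_guard g) w <-> sat_stamps k (grid_stamps w) g.
Proof.
split=> [[t [_ [tP]]]|sat_g]; first by rewrite (holds_enc_guard tP).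
have [t [t_lt tP]] := truth_table_exists w (enc_guard g).+1.
by exists t; split=> //; split=> //; rewrite (holds_enc_guard tP).
Qed.

Lemma sat_stamps_bounded p q g : enc_guard g <= x -> stamps_equiv n M p q ->
  sat_stamps k p g <-> sat_stamps k q g.
Proof.
by move=> /enc_guard_over g_over pq; apply: (sat_stamps_equiv pq _ _ g_over); rewrite ?leq_addr.
Qed.

Lemma reset_codeP r Y i : reset_code k (enc_rule r) Y i <->
  (i < k /\ digit 2 Y i = 1) \/ (k <= i /\ i - k \in r_reset r).
Proof. by rewrite /reset_code rule_codeE in_code_id. Qed.

Lemma entry_le_box v i : entry v i <= box k m x.
Proof. by rewrite -ltnS; apply: digit_lt. Qed.

Lemma vector_exists (u : nat -> nat) : (forall i, i <= n -> u i <= box k m x) ->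
  exists v, v < nvectors k m x /\ forall i, i <= n -> entry v i = u i.
Proof. exact: (@digits_exist (box k m x).+1 n.+1 u). Qed.

Lemma elapse_exists p t : (p 0%N <= t)%R -> exists v w,
  [/\ v < nvectors k m x, w < nvectors k m x, represents v p,
      represents w (set_now p t) & elapse_code k m x v w].
Proof.
move=> p_t; pose q i := if i == n.+1 then t else p i.
have [u [u_rep u_le]] := @bounded_grid_rep n.+2 M q.
have [i i_n|v [v_lt v_u]] := @vector_exists u; first by apply: u_le; lia.
have [[|i] i_n|w [w_lt w_u]] := @vector_exists (fun i => if i is 0 then u n.+1 else u i).
- by apply: u_le.
- by apply: u_le; lia.
have q_p i : i <= n -> q i = p i by rewrite /q => i_n; case: eqP => // ?; lia.
have q_t : q n.+1 = t by rewrite /q eqxx.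
exists v, w; split=> //.
- move=> i j i_n j_n z zM; rewrite grid_diff_lt !v_u // -u_rep ?q_p //; lia.
- move=> i j i_n j_n z zM; rewrite grid_diff_lt !w_u //.
  by case: i i_n => [|i] i_n; case: j j_n => [|j] j_n; rewrite -u_rep ?q_t ?q_p //=; lia.
split=> [i i_n|]; first by rewrite w_u ?v_u //; lia.
rewrite w_u // v_u // leqNgt; apply/negP => u_lt.
have := u_rep n.+1 0 ltac:(lia) isT 0%Z ltac:(lia); rewrite q_t q_p // => -[_]; move: u_lt p_t.
by move=> ? ? /(_ ltac:(lia)); lra.
Qed.

Lemma elapse_stamps v w i : elapse_code k m x v w -> i <= n ->
  grid_stamps w i = set_now (grid_stamps v) (grid_stamps w 0) i.
Proof. by case=> same_resets _; case: i => [|i] i_n //=; rewrite /grid_stamps same_resets. Qed.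

Lemma elapse_now v w : elapse_code k m x v w -> (grid_stamps v 0 <= grid_stamps w 0)%R.
Proof.
case=> _ /leP/le_INR le_now; rewrite /grid_stamps.
by have := Rinv_0_lt_compat _ grid_gt0; rewrite /Rdiv; nra.
Qed.

Lemma update_stamps e Y w u' i : update_code k m x e Y w u' -> i <= n ->
  grid_stamps u' i = reset_stamps (reset_code k e Y) (grid_stamps w) i.
Proof.
case=> now_u' resets; case: i => [|i] i_n; rewrite /grid_stamps /= ?now_u' //.
by have [hit_i miss_i] := resets i i_n; case: asboolP => [/hit_i|/miss_i] ->.
Qed.

Lemma update_exists e Y w : exists u', u' < nvectors k m x /\ update_code k m x e Y w u'.
Proof.
have [[|i] _|u' [u'_lt u'E]] := @vector_exists (fun i => if i is i'.+1 then
    if `[< reset_code k e Y i' >] then entry w 0 else entry w i else entry w 0).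
- exact: entry_le_box.
- by case: ifP => _; apply: entry_le_box.
exists u'; split=> //; split=> [|i i_n]; rewrite u'E //.
by case: asboolP.
Qed.

Lemma edge_simulates r Y u p t : enc_guard (r_guard r) <= x ->
  represents u p -> (p 0%N <= t)%R ->
  sat_stamps k (set_now p t) (r_guard r) ->
  exists w u', [/\ w < nvectors k m x, u' < nvectors k m x,
    edge_code k m x (enc_rule r) Y u w u', represents w (set_now p t) &
    represents u' (reset_stamps (reset_code k (enc_rule r) Y) (set_now p t))].
Proof.
move=> g_x up p_t sat_g; have [v [w [v_lt w_lt vp wp vw]]] := elapse_exists p_t.
have [u' [u'_lt wu']] := update_exists (enc_rule r) Y w.
exists w, u'; split=> //; last first.
  apply: eq_stamps_equiv (stamps_equiv_reset _ wp) => // i i_n.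
  by rewrite (update_stamps wu' i_n).
split.
  exists v; split=> //; split=> //; apply/equiv_codeP.
  exact: stamps_equiv_trans up (stamps_equiv_sym vp).
split=> //; rewrite rule_codeE; apply/sat_codeP.
exact/(sat_stamps_bounded g_x wp).
Qed.

Lemma edge_realizable r Y u w u' p : enc_guard (r_guard r) <= x ->
  edge_code k m x (enc_rule r) Y u w u' -> represents u p -> past n p ->
  exists t, [/\ (p 0%N <= t)%R, sat_stamps k (set_now p t) (r_guard r),
    represents w (set_now p t) &
    represents u' (reset_stamps (reset_code k (enc_rule r) Y) (set_now p t))].
Proof.
move=> g_x [[v [_ [/equiv_codeP uv vw]]] [sat_w wu']] up past_p.
have pv := stamps_equiv_trans (stamps_equiv_sym up) uv.
have past_v := past_equiv pv past_p.
have [t [p_t vt]] := elapse_match (stamps_equiv_sym pv) past_v (elapse_now vw).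
have wp : represents w (set_now p t).
  by apply: eq_stamps_equiv vt => // i i_n; rewrite (elapse_stamps vw i_n).
exists t; split=> //; last first.
  apply: eq_stamps_equiv (stamps_equiv_reset _ wp) => // i i_n.
  by rewrite (update_stamps wu' i_n).
move: sat_w; rewrite rule_codeE => /sat_codeP.
by move/(sat_stamps_bounded g_x wp).
Qed.
End Grid.

(** * Runs of the automaton against a controller *)

Definition is_letter r := isSome (r_lab r).
Arguments is_letter : simpl never.

Section ControlledRun.
Variables (k nA nB : nat) (L : Type) (l0 : L).
Variable delta : L -> 'I_nA -> ('I_k -> R) -> L * 'I_nB * {set 'I_k}.
Variables (a : nat -> 'I_nA) (t : nat -> R) (r : nat -> rule) (s : nat -> R) (f : nat -> nat).
Notation letter := (fun j => is_letter (r j)).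
Notation played := (ncount letter).
Hypotheses (enum_f : enumerates letter f) (time_f : forall i, s (f i) = t i).
Let state i := ctrl_state l0 delta a t i.

Definition answer i := delta (state i).1 (a i) (elapse t (state i).2 i).

Definition run_stamps j i : R :=
  if i is i'.+1 then
    if i' < k then (prev t (played j) - ext_val (state (played j)).2 i')%R
    else (prev s j - run_val r s j (i' - k))%R
  else prev s j.

Definition run_resets j i : Prop :=
  (exists ik : i < k, is_letter (r j) /\ Ordinal ik \in (answer (played j)).2) \/
  (k <= i /\ i - k \in r_reset (r j)).

Lemma ctrl_stateS i : state i.+1 = ((answer i).1.1,
  fun y => if y \in (answer i).2 then 0%R else elapse t (state i).2 i y).
Proof.
rewrite /answer /state /=; case: (ctrl_state _ _ _ _ i) => l mu /=.
by case: (delta _ _ _) => [[l' b] Y].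
Qed.

Lemma ctrl_outE i : ctrl_out l0 delta a t i = (answer i).1.2.
Proof. by rewrite /ctrl_out /answer /state; case: (ctrl_state _ _ _ _ i). Qed.

Lemma run_stamps0 : run_stamps 0 = fun=> 0%R.
Proof.
apply: funext => -[|i] //=; case: ifP => ik; last by lra.
by rewrite (ext_valE _ ik) /=; lra.
Qed.

Lemma time_played j : is_letter (r j) -> t (played j) = s j.
Proof. by move=> letter_j; rewrite -time_f (enum_ncount enum_f). Qed.

Lemma run_stampsS j :
  run_stamps j.+1 = reset_stamps (run_resets j) (set_now (run_stamps j) (s j)).
Proof.
apply: funext => -[|i] //=; case: (ltnP i k) => [ik|ki]; last first.
  case: asboolP => [[[ik] _|[_ ->]]|not_reset]; [lia|lra|].
  by rewrite ifN; [lra|apply: contra_notN not_reset; right].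
rewrite !(ext_valE _ ik); case: (boolP (is_letter (r j))) => letter_j; last first.
  rewrite ifF; first by rewrite addn0.
  by apply/asboolP => -[[_ [letter_j' _]]|[]]; [rewrite letter_j' in letter_j|lia].
rewrite addn1 ctrl_stateS /= (time_played letter_j).
case: asboolP => [[[ik' [_]]|[]]|not_reset]; [|lia|].
  by rewrite (bool_irrelevance ik ik') => ->; lra.
rewrite ifN /elapse ?(time_played letter_j); first by lra.
by apply: contra_notN not_reset; left; exists ik.
Qed.

Lemma elapse_run_stamps j : is_letter (r j) ->
  elapse t (state (played j)).2 (played j) = stamps_val (set_now (run_stamps j) (s j)).
Proof.
move=> letter_j; apply: funext => -[y yk].
by rewrite /stamps_val /= yk (ext_valE _ yk) /elapse (time_played letter_j); lra.
Qed.

Lemma sat_run_stamps j g : sat (fun y => (run_val r s j y + (s j - prev s j))%R) g <->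
  sat_stamps k (set_now (run_stamps j) (s j)) g.
Proof. by apply: eq_sat => y; rewrite /clock_entry addSn /= ltnNge leq_addr addKn /=; lra. Qed.
End ControlledRun.

(** * From certificates to controllers *)

Section RegionRepresentative.
Variables k m x : nat.
Implicit Types nu : 'I_k -> R.

Definition vector_val v : 'I_k -> R := stamps_val (grid_stamps k m x v).

Lemma region_equiv_sym nu nu' : region_equiv m nu nu' -> region_equiv m nu' nu.
Proof. by move=> equiv g over_g; rewrite equiv. Qed.

Lemma region_equiv_trans nu nu' nu'' :
  region_equiv m nu nu' -> region_equiv m nu' nu'' -> region_equiv m nu nu''.
Proof. by move=> equiv equiv' g over_g; rewrite equiv // equiv'. Qed.

Lemma nvectors_gt0 : 0 < nvectors k m x.
Proof. by rewrite expn_gt0. Qed.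

Definition region_vector nu : 'I_(nvectors k m x) :=
  odflt (Ordinal nvectors_gt0)
    [pick v : 'I_(nvectors k m x) | `[< region_equiv m nu (vector_val v) >]].

Lemma eq_region_vector nu nu' : region_equiv m nu nu' -> region_vector nu = region_vector nu'.
Proof.
move=> equiv; congr odflt; apply: eq_pick => v; apply: asbool_equiv_eq; split.
  exact/region_equiv_trans/region_equiv_sym.
exact: region_equiv_trans.
Qed.

Lemma region_vectorP nu w : w < nvectors k m x -> region_equiv m nu (vector_val w) ->
  region_equiv m nu (vector_val (region_vector nu)).
Proof.
move=> w_lt equiv; rewrite /region_vector; case: pickP => [v /asboolP//|none].
by have /asboolP := none (Ordinal w_lt).
Qed.
End RegionRepresentative.

Section CertifiedController.
Variables (k m : nat) (I : instance) (rk : nat -> nat -> nat -> nat -> nat).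
Let x := enc_instance I.
Hypothesis cert : certificate k m x rk.
Let memory := 'I_(nmemory k m x).
Let final r := r_src r \in ta_final (i_ta I).

Definition good_answer (p : memory) (a c : nat) (o : memory * 'I_(i_nB I) * nat) : Prop :=
  forall (f : bool) r, List.In r (ta_rules (i_ta I)) -> r_lab r = Some (a, nat_of_ord o.1.2) ->
  forall u w u', u < nvectors k m x -> w < nvectors k m x -> u' < nvectors k m x ->
  edge_code k m x (enc_rule r) o.2 u w u' -> equiv_code k m x k m w c ->
  0 < rk p f (r_src r) u ->
  0 < rk o.1.1 0 (r_dst r) u' /\
  rk o.1.1 0 (r_dst r) u' + (f || final r) <= rk p f (r_src r) u.

Lemma good_answer_exists (p : memory) (a : 'I_(i_nA I)) (c : 'I_(nvectors k m x)) :
  exists o, good_answer p a c o.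
Proof.
have [_ [_ answers]] := cert.
have a_lt : a < inputs_code x by rewrite instance_codeE.
have [b [b_lt [Y [Y_lt [p' [p'_lt answer_b]]]]]] := answers p (ltn_ord p) a a_lt c (ltn_ord c).
rewrite instance_codeE in b_lt; exists (Ordinal p'_lt, Ordinal b_lt, Y).
move=> f r r_in lab_r u w u' u_lt w_lt u'_lt uu' wc; have [e_le _ _ _] := rule_bound r_in.
have := answer_b f _ (f || final r) _ (enc_rule r) e_le (rule_in_code r_in) _ _
  u u_lt w w_lt u' u'_lt uu' wc.
rewrite !rule_codeE lab_r; apply=> //; [by case: f|by case: (_ || _)|exact/flag_codeP].
Qed.

Lemma silent_edge (p : memory) (f : bool) r u w u' :
  List.In r (ta_rules (i_ta I)) -> r_lab r = None ->
  u < nvectors k m x -> w < nvectors k m x -> u' < nvectors k m x ->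
  edge_code k m x (enc_rule r) 0 u w u' -> 0 < rk p f (r_src r) u ->
  0 < rk p (f || final r) (r_dst r) u' /\ rk p (f || final r) (r_dst r) u' <= rk p f (r_src r) u.
Proof.
move=> r_in lab_r u_lt w_lt u'_lt uu'; have [e_le _ _ _] := rule_bound r_in.
have [_ [silent _]] := cert.
have := silent p (ltn_ord p) f _ (f || final r) _ (enc_rule r) e_le (rule_in_code r_in) _ _
  u u_lt w w_lt u' u'_lt uu'.
rewrite !rule_codeE lab_r; apply=> //; [by case: f|by case: (_ || _)|exact/flag_codeP].
Qed.

Section Reply.
Variable p0 : memory.
Variable reply : memory -> 'I_(i_nA I) -> 'I_(nvectors k m x) -> memory * 'I_(i_nB I) * nat.
Hypothesis reply_good : forall p (a : 'I_(i_nA I)) (c : 'I_(nvectors k m x)),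
  good_answer p a c (reply p a c).
Hypothesis p0_gt0 : forall l, l \in ta_init (i_ta I) -> 0 < rk p0 0 l 0.

Definition certified_ctrl (p : memory) (a : 'I_(i_nA I)) (nu : 'I_k -> R) :
    memory * 'I_(i_nB I) * {set 'I_k} :=
  let o := reply p a (region_vector m x nu) in (o.1, [set i : 'I_k | digit 2 o.2 i == 1]).

Lemma certified_ctrl_invariant : region_invariant m certified_ctrl.
Proof. by move=> p a nu nu' equiv; rewrite /certified_ctrl (eq_region_vector x equiv). Qed.

Section Play.
Variables (a : nat -> 'I_(i_nA I)) (t : nat -> R) (r : nat -> rule) (s : nat -> R) (f : nat -> nat).
Hypothesis run_r : accepting_run (i_ta I) r s.
Notation letter := (fun j => is_letter (r j)).
Notation played := (ncount letter).
Hypotheses (enum_f : enumerates letter f) (time_f : forall i, s (f i) = t i).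
Hypothesis lab_f : forall i, r_lab (r (f i)) =
  Some (nat_of_ord (a i), nat_of_ord (ctrl_out p0 certified_ctrl a t i)).

Let stamps := run_stamps p0 certified_ctrl a t r s.
Let memory_at j := (ctrl_state p0 certified_ctrl a t (played j)).1.
Let val_at j := elapse t (ctrl_state p0 certified_ctrl a t (played j)).2 (played j).
Let reply_at j := reply (memory_at j) (a (played j)) (region_vector m x (val_at j)).
Let resets_at j := if is_letter (r j) then (reply_at j).2 else 0.

Fixpoint run_flag j :=
  if j is j'.+1 then ~~ is_letter (r j') && (run_flag j' || final (r j')) else false.

Definition tracks j u := u < nvectors k m x /\ represents k m x u (stamps j).
Definition run_rank j u := rk (memory_at j) (run_flag j) (r_src (r j)) u.

Lemma rule_in j : List.In (r j) (ta_rules (i_ta I)).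
Proof. by have [_ [rules _]] := run_r. Qed.

Lemma reset_code_run j : reset_code k (enc_rule (r j)) (resets_at j) =
  run_resets p0 certified_ctrl a t r j.
Proof.
apply: funext => i; apply: propext; rewrite reset_codeP /run_resets /resets_at.
case: (boolP (is_letter (r j))) => letter_j; split=> -[[ik]|]; try by right.
- by move=> digit_i; left; exists ik; rewrite /answer /= inE digit_i.
- by case=> _; rewrite /answer /= inE => /eqP; left.
- by rewrite digit0.
- by case.
Qed.

Lemma tracks_edge j u : tracks j u -> exists w u', [/\ w < nvectors k m x, tracks j.+1 u',
  edge_code k m x (enc_rule (r j)) (resets_at j) u w u' &
  represents k m x w (set_now (stamps j) (s j))].
Proof.
case=> u_lt u_stamps; have [_ [_ [_ [time [guards _]]]]] := run_r.
have [_ _ g_x _] := rule_bound (rule_in j).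
have sat_j : sat_stamps k (set_now (stamps j) (s j)) (r_guard (r j)) by apply/sat_run_stamps.
have [w [u' [w_lt u'_lt uu' w_stamps u'_stamps]]] :=
  edge_simulates (resets_at j) g_x u_stamps (time j) sat_j.
exists w, u'; split=> //; split=> //.
by rewrite /stamps (run_stampsS _ _ _ enum_f time_f) -reset_code_run.
Qed.

Lemma silent_step j u : ~~ is_letter (r j) -> tracks j u -> 0 < run_rank j u ->
  exists u', tracks j.+1 u' /\ 0 < run_rank j.+1 u' <= run_rank j u.
Proof.
move=> silent_j tracks_u rank_u; have [_ [_ [chain _]]] := run_r.
have [w [u' [w_lt tracks_u' uu' _]]] := tracks_edge tracks_u.
have lab_j : r_lab (r j) = None by move: silent_j; rewrite /is_letter; case: (r_lab _).
rewrite /resets_at (negbTE silent_j) in uu'.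
have rank_u' := silent_edge (rule_in j) lab_j tracks_u.1 w_lt tracks_u'.1 uu' rank_u.
exists u'; split=> //; rewrite /run_rank /memory_at /= silent_j (negbTE silent_j) addn0 -chain.
exact/andP.
Qed.

Lemma letter_step j u : is_letter (r j) -> tracks j u -> 0 < run_rank j u ->
  exists u', tracks j.+1 u' /\
    0 < run_rank j.+1 u' /\ run_rank j.+1 u' + (run_flag j || final (r j)) <= run_rank j u.
Proof.
move=> letter_j tracks_u rank_u; have [_ [_ [chain _]]] := run_r.
have [w [u' [w_lt tracks_u' uu' w_stamps]]] := tracks_edge tracks_u.
rewrite /resets_at letter_j in uu'.
have lab_j : r_lab (r j) = Some (nat_of_ord (a (played j)), nat_of_ord (reply_at j).1.2).
  by rewrite -{1}(enum_ncount enum_f letter_j) lab_f ctrl_outE.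
have w_region : equiv_code k m x k m w (region_vector m x (val_at j)).
  have w_val : region_equiv m (val_at j) (@vector_val k m x w).
    rewrite /val_at (elapse_run_stamps _ _ _ enum_f time_f letter_j).
    apply/region_equivP/stamps_equiv_sym; apply: stamps_equivW w_stamps.
      exact: leq_addr.
    exact: leq_addl.
  apply/equiv_codeP/region_equivP; apply: region_equiv_trans (region_equiv_sym w_val) _.
  exact: region_vectorP w_val.
have rank_u' := reply_good (rule_in j) lab_j tracks_u.1 w_lt tracks_u'.1 uu' w_region rank_u.
exists u'; split=> //; rewrite /run_rank /memory_at /= letter_j addn1 ctrl_stateS -chain.
exact: rank_u'.
Qed.

Lemma run_step j u : tracks j u /\ 0 < run_rank j u -> exists u',
  (tracks j.+1 u' /\ 0 < run_rank j.+1 u') /\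
  run_rank j.+1 u' + (is_letter (r j) && (run_flag j || final (r j))) <= run_rank j u.
Proof.
case=> tracks_u rank_u; case: (boolP (is_letter (r j))) => [letter_j|silent_j].
  by have [u' [? []]] := letter_step letter_j tracks_u rank_u; exists u'.
have [u' [tracks_u' /andP[rank_gt0 rank_le]]] := silent_step silent_j tracks_u rank_u.
by exists u'; rewrite addn0.
Qed.

Lemma tracks_start : tracks 0 0 /\ 0 < run_rank 0 0.
Proof.
split; last by apply: p0_gt0; have [] := run_r.
split; first exact: nvectors_gt0.
by rewrite /stamps run_stamps0; apply: represents0.
Qed.

Lemma certified_play_absurd : False.
Proof.
have [u [_ _ rank_drop]] := dependent_choice tracks_start run_step.
have [_ [_ [_ [_ [_ inf_final]]]]] := run_r.
have accepted := flagged_letters (flag := run_flag) (fun=> erefl)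
  (enum_infinitely_often enum_f) inf_final.
apply: (@no_infinite_descent (fun j => run_rank j (u j)) 0) => [j _|N].
  by apply: leq_trans (rank_drop j); apply: leq_addr.
have [j [Nj accept_j]] := accepted N; exists j; split=> //.
by have := rank_drop j; rewrite accept_j addn1.
Qed.
End Play.
End Reply.

Theorem certificate_controller : has_winning_controller k m I.
Proof.
have /choice[reply reply_good] (pac : memory * 'I_(i_nA I) * 'I_(nvectors k m x)) :
  exists o, good_answer pac.1.1 pac.1.2 pac.2 o by apply: good_answer_exists.
have [[p0 [p0_lt p0_init]] _] := cert.
pose ctrl := certified_ctrl (fun p a c => reply (p, a, c)).
exists memory, (Ordinal p0_lt), ctrl; split; first exact: certified_ctrl_invariant.
move=> a t _ [r [s [f [run_r [f_lt [fP labels]]]]]].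
apply: (@certified_play_absurd (Ordinal p0_lt) (fun p a c => reply (p, a, c)) _ _ a t r s f) => //.
- by move=> p a' c; apply: (reply_good (p, a', c)).
- by move=> l l_init; apply: p0_init; [apply: init_bound|rewrite instance_codeE in_code_id].
- by split=> // j; rewrite -fP /is_letter; case: (r_lab _).
- by move=> i; have [] := labels i.
- by move=> i; have [] := labels i.
Qed.
End CertifiedController.

(** * From controllers to certificates *)

Section RegionGame.
Variables (k m : nat) (I : instance).
Let x := enc_instance I.
Let nv := nvectors k m x.
Let final r := r_src r \in ta_final (i_ta I).

(* A state is a flag, a location and a vector; an input of the game is a letter and a
   vector representing the region of the controller clocks. *)
Definition game_state : finType := (bool * 'I_x.+1 * 'I_nv)%type.
Definition game_input : finType := ('I_(i_nA I) * 'I_nv)%type.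
Definition game_output : finType := ('I_(i_nB I) * 'I_(2 ^ k))%type.
Implicit Types (q : game_state) (i : game_input) (o : game_output).

Definition game_init : pred game_state := fun q =>
  [&& ~~ q.1.1, val q.1.2 \in ta_init (i_ta I) & val q.2 == 0].

Definition raised r q := q.1.1 || final r.

Definition rule_edge r Y q w q' := [/\ List.In r (ta_rules (i_ta I)), r_src r = q.1.2,
  r_dst r = q'.1.2, w < nv & edge_code k m x (enc_rule r) Y q.2 w q'.2].

Definition game_eps : rel game_state := fun q q' =>
  `[< exists r w, [/\ rule_edge r 0 q w q', r_lab r = None & q'.1.1 = raised r q] >].

Definition game_letter i o q (f : bool) q' : bool :=
  `[< exists r w, [/\ rule_edge r o.2 q w q', r_lab r = Some (val i.1, val o.1),
    q'.1.1 = false, f = raised r q & equiv_code k m x k m w i.2] >].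

Section FromController.
Variables (L : finType) (l0 : L).
Variable delta : L -> 'I_(i_nA I) -> ('I_k -> R) -> L * 'I_(i_nB I) * {set 'I_k}.
Hypothesis invariant : region_invariant m delta.
Hypothesis winning_ctrl : forall (a : nat -> 'I_(i_nA I)) (t : nat -> R),
  (forall n, (prev t n <= t n)%R) ->
  ~ in_lang (i_ta I)
    (fun n => ((a n, ctrl_out l0 delta a t n), t n) : ('I_(i_nA I) * 'I_(i_nB I)) * R).
Variable subset_code : {set 'I_k} -> 'I_(2 ^ k).
Hypothesis subset_codeE : forall Y (i : 'I_k), digit 2 (subset_code Y) i = (i \in Y).

Definition game_answer l i := delta l i.1 (@vector_val k m x i.2).
Definition game_out l i : game_output := ((game_answer l i).1.2, subset_code (game_answer l i).2).
Definition game_nxt l i := (game_answer l i).1.1.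
Let accepting := letter_move game_letter game_out game_nxt true.

Section Path.
Variable p : nat -> L * game_state.
Let mem j := (p j).1.
Let flag j := (p j).2.1.1.
Let vec j : nat := (p j).2.2.

Definition output_code j (inp : option game_input) : nat :=
  if inp is Some i then (game_out (mem j) i).2 else 0.

Definition explains j (ex : rule * nat * option game_input) :=
  let: (r, w, inp) := ex in
  [/\ rule_edge r (output_code j inp) (p j).2 w (p j.+1).2,
    is_letter r = inp,
    flag j.+1 = ~~ inp && raised r (p j).2,
    accepting (p j) (p j.+1) -> inp && raised r (p j).2 &
    if inp is Some i then
      [/\ r_lab r = Some (val i.1, val (game_out (mem j) i).1), mem j.+1 = game_nxt (mem j) i &
        equiv_code k m x k m w i.2]
    else mem j.+1 = mem j].

Lemma explains_exists j :
  move game_eps game_letter game_out game_nxt (p j) (p j.+1) -> exists ex, explains j ex.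
Proof.
have explain_letter f : letter_move game_letter game_out game_nxt f (p j) (p j.+1) ->
    (accepting (p j) (p j.+1) -> f) -> exists ex, explains j ex.
  case/existsP=> i /andP[/eqP mem_j /asboolP[r [w [edge_r lab_r flag_r f_r w_i]]]] acc.
  exists (r, w, Some i); split=> //=; first by rewrite /is_letter lab_r.
  by rewrite -f_r.
case: (boolP (accepting (p j) (p j.+1))) => [acc _|not_acc]; first exact: (explain_letter true).
rewrite /= -/accepting (negbTE not_acc) orbF; case/orP=> [/andP[/eqP mem_j]|plain].
  case/asboolP=> r [w [edge_r lab_r flag_r]]; exists (r, w, None).
  by split=> //=; [rewrite /is_letter lab_r|rewrite (negbTE not_acc)].
by apply: (explain_letter false) => //; rewrite (negbTE not_acc).
Qed.

Section Explained.
Variables (r : nat -> rule) (w : nat -> nat) (inp : nat -> option game_input).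
Hypothesis explained : forall j, explains j (r j, w j, inp j).
Hypothesis init_p : initial game_init l0 (p 0).
Hypothesis accepting_p : infinitely_often (fun j => accepting (p j) (p j.+1)).
Notation letter := (fun j => is_letter (r j)).
Notation played := (ncount letter).
Let resets j := reset_code k (enc_rule (r j)) (output_code j (inp j)).

Definition realizes (P : nat -> nat -> R) (s : nat -> R) := [/\ P 0 = fun=> 0%R,
  forall j, P j.+1 = reset_stamps (resets j) (set_now (P j) (s j)) &
  forall j, [/\ (P j 0%N <= s j)%R, sat_stamps k (set_now (P j) (s j)) (r_guard (r j)) &
    represents k m x (w j) (set_now (P j) (s j))]].

Lemma path_realizable : exists P s, realizes P s.
Proof.
pose sim j P := represents k m x (vec j) P /\ past (nclocks k x) P.
pose step j (P P' : nat -> R) := exists t, [/\ P' = reset_stamps (resets j) (set_now P t),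
  (P 0%N <= t)%R, sat_stamps k (set_now P t) (r_guard (r j)) &
  represents k m x (w j) (set_now P t)].
have sim0 : sim 0 (fun=> 0%R).
  split=> [|i _]; last exact: Rle_refl.
  have /andP[_ /and3P[_ _ /eqP vec0]] := init_p.
  by rewrite /vec vec0; apply: represents0.
have simS j P : sim j P -> exists P', sim j.+1 P' /\ step j P P'.
  case=> vec_P past_P; have [[r_in _ _ _ edge_j] _ _ _ _] := explained j.
  have [_ _ g_x _] := rule_bound r_in.
  have [t [P_t sat_t w_t vec_t]] := edge_realizable g_x edge_j vec_P past_P.
  exists (reset_stamps (resets j) (set_now P t)); split; last by exists t.
  by split=> //; apply/past_reset/past_set_now.
have [P [P0 _ PS]] := dependent_choice sim0 simS.
have [s sP] := choice PS; exists P, s; split=> // j; first by have [] := sP j.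
by have [] := sP j.
Qed.

Lemma path_letters : infinitely_often (fun j => is_letter (r j)).
Proof.
move=> N; have [j [Nj acc_j]] := accepting_p N; exists j; split=> //.
by have [_ -> _ /(_ acc_j)/andP[]] := explained j.
Qed.

Lemma path_final : infinitely_often (fun j => final (r j)).
Proof.
apply: (flagged_final (letter := letter) (flag := flag)) => [j|N].
  by have [_ -> -> _ _] := explained j.
have [j [Nj acc_j]] := accepting_p N; exists j; split=> //.
by have [_ -> _ /(_ acc_j)] := explained j.
Qed.

Section Realized.
Variables (P : nat -> nat -> R) (s : nat -> R) (f : nat -> nat) (i0 : game_input).
Hypotheses (real_P : realizes P s) (enum_f : enumerates letter f).
Let a n := (odflt i0 (inp (f n))).1.
Let t n := s (f n).
Let time_f n : s (f n) = t n := erefl.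

Lemma realized_time j : (prev s j <= s j)%R.
Proof.
have [P0 PS Pj] := real_P; have [+ _ _] := Pj j.
by case: j => [|j]; rewrite ?P0 ?PS.
Qed.

Lemma letter_time n : (prev t n <= t n)%R.
Proof.
have mono j j' : j <= j' -> (prev s j <= prev s j')%R.
  by apply: (homo_leq Rle_refl (fun y x z => @Rle_trans x y z)) => l; apply: realized_time.
case: n => [|n]; first exact: (mono 0 (f 0).+1).
by apply: (mono (f n).+1 (f n.+1).+1); rewrite ltnS ltnW // (proj1 enum_f).
Qed.

Definition matches j := mem j = (ctrl_state l0 delta a t (played j)).1 /\
  P j = run_stamps l0 delta a t r s j.

Lemma answer_matches j i : matches j -> inp j = Some i ->
  answer l0 delta a t (played j) = game_answer (mem j) i.
Proof.
case=> mem_j P_j inp_j; have [_ letter_j _ _] := explained j; rewrite inp_j => -[_ _ w_i].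
have {}letter_j : is_letter (r j) by rewrite letter_j inp_j.
rewrite /answer -mem_j /a (enum_ncount enum_f letter_j) inp_j /game_answer; apply: invariant.
rewrite (elapse_run_stamps _ _ _ enum_f time_f letter_j) -P_j.
have [_ _ Pj] := real_P; have [_ _ w_P] := Pj j; apply/region_equivP.
apply: stamps_equiv_trans (proj1 (equiv_codeP _ _ _ _ _ _ _) w_i).
by apply/stamps_equiv_sym; apply: stamps_equivW w_P; [apply: leq_addr|apply: leq_addl].
Qed.

Lemma resets_match j : matches j -> resets j = run_resets l0 delta a t r j.
Proof.
move=> match_j; apply: funext => y; apply: propext; rewrite /resets reset_codeP /run_resets.
have [_ -> _ _ _] := explained j; case inp_j: (inp j) => [i|] /=; last first.
  by rewrite digit0; split=> -[[? []]|]; try right.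
rewrite (answer_matches match_j inp_j); split=> -[[yk]|]; try by right.
  by rewrite (subset_codeE _ (Ordinal yk)); case in_Y: (Ordinal yk \in _) => // _; left; exists yk.
by case=> _ in_Y; left; split=> //; rewrite (subset_codeE _ (Ordinal yk)) in_Y.
Qed.

Lemma path_matches j : matches j.
Proof.
have [P0 PS _] := real_P; elim: j => [|j match_j].
  by have /andP[/eqP mem0 _] := init_p; split; rewrite ?run_stamps0.
split; last by rewrite PS (run_stampsS _ _ _ enum_f time_f) -(resets_match match_j) (proj2 match_j).
have [_ letter_j _ _ mem_j] := explained j; move: mem_j letter_j.
rewrite /=; case inp_j: (inp j) => [i|] /=; last by case: match_j => mem_j _ -> ->; rewrite addn0.
by case=> _ -> _ ->; rewrite addn1 ctrl_stateS (answer_matches match_j inp_j).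
Qed.

Lemma path_in_lang : in_lang (i_ta I)
  (fun n => ((a n, ctrl_out l0 delta a t n), t n) : ('I_(i_nA I) * 'I_(i_nB I)) * R).
Proof.
have edge j : rule_edge (r j) (output_code j (inp j)) (p j).2 (w j) (p j.+1).2.
  by have [] := explained j.
have [_ _ Pj] := real_P; have [f_lt fP] := enum_f; exists r, s, f; split.
  split; [|split; [|split; [|split; [|split]]]].
  - have [_ -> _ _ _] := edge 0; by have /andP[_ /and3P[]] := init_p.
  - by move=> j; have [] := edge j.
  - by move=> j; have [_ _ -> _ _] := edge j; have [_ -> _ _ _] := edge j.+1.
  - exact: realized_time.
  - move=> j; apply/(sat_run_stamps l0 delta a t); rewrite -(proj2 (path_matches j)).
    by have [] := Pj j.
  - exact: path_final.
split=> //; split=> [j|n]; first by rewrite -fP /is_letter; case: (r_lab _).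
split=> //=; have letter_n : is_letter (r (f n)) by apply/fP; exists n.
have [_ letter_inp _ _] := explained (f n); rewrite letter_n in letter_inp.
case inp_n: (inp (f n)) letter_inp => [i|] // _ [-> _ _].
have := answer_matches (path_matches (f n)) inp_n; rewrite (ncount_enum n enum_f) => answer_n.
by rewrite ctrl_outE answer_n /a inp_n.
Qed.
End Realized.

Lemma explained_path_absurd : False.
Proof.
have [P [s real_P]] := path_realizable; have [f enum_f] := infinitely_often_enum path_letters.
have [i0] : exists i0 : game_input, true.
  have [j [_ letter_j]] := path_letters 0; have [_ letter_inp _ _ _] := explained j.
  by move: letter_inp; rewrite letter_j; case: (inp j) => // i _; exists i.
move=> _; exact: winning_ctrl (letter_time real_P enum_f) (path_in_lang i0 real_P enum_f).
Qed.
End Explained.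
End Path.

Theorem controller_winning : winning game_init game_eps game_letter l0 game_out game_nxt.
Proof.
case/lasso_path=> p [init_p edge_p accepting_p].
have [ex exP] := choice (fun j => explains_exists (edge_p j)).
apply: (@explained_path_absurd p (fun j => (ex j).1.1) (fun j => (ex j).1.2)
  (fun j => (ex j).2)) => //.
by move=> j; have := exP j; case: (ex j) => -[].
Qed.
End FromController.

Section Tabulation.
Variable rk : 'I_(nmemory k m x) -> game_state -> nat.

Definition tabulates y := forall (p : 'I_(nmemory k m x)) (f : bool) (l : 'I_x.+1) (u : 'I_nv),
  table k m x y p f l u = rk p (f, l, u).

Lemma tabulates_exists : (forall p q, rk p q < max_rank k m x) ->
  exists y, y < max_rank k m x ^ (nmemory k m x * nstates k m x) /\ tabulates y.
Proof.
pose index (pq : 'I_(nmemory k m x) * game_state) :=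
  state_index k m x pq.1 pq.2.1.1 pq.2.1.2 pq.2.2.
have index_inj : injective index.
  move=> [p [[f l] u]] [p' [[f' l'] u']] /state_index_inj[] //=; [by case: f|by case: f'|].
  move=> /val_inj-> eq_f /val_inj-> /val_inj->.
  by case: f f' eq_f => [] [].
pose value pos := if [pick pq | index pq == pos] is Some pq then rk pq.1 pq.2 else 0.
move=> rk_lt; have [pos _|y [y_lt digit_y]] :=
    @digits_exist (max_rank k m x) (nmemory k m x * nstates k m x) value isT.
  by rewrite /value; case: pickP => // pq _.
exists y; split=> // p f l u; rewrite /table digit_y; last by apply: state_index_lt => //; case: f.
rewrite /value; case: pickP => [pq /eqP|/(_ (p, (f, l, u)))]; last by rewrite eqxx.
by rewrite -[state_index _ _ _ _ _ _ _]/(index (p, (f, l, u))) => /index_inj->.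
Qed.

Variable p0 : 'I_(nmemory k m x).
Hypothesis measure : progress_measure game_init game_eps game_letter p0 rk.
Variable y : nat.
Hypothesis tab : tabulates y.

Lemma bool_of_lt2 f : f < 2 -> exists b : bool, f = b.
Proof. by case: f => [|[|//]] _; [exists false|exists true]. Qed.

Lemma rule_of_code e : in_code (rules_code x) e ->
  exists2 r, List.In r (ta_rules (i_ta I)) & e = enc_rule r.
Proof. by rewrite instance_codeE in_codeP => -[r [r_in <-]]; exists r. Qed.

Lemma tabulated_init : cert_init k m x (table k m x y).
Proof.
have [rk_init _ _] := measure; exists p0; split=> // l l_lt.
rewrite instance_codeE in_code_id => l_init.
have := tab p0 false (Ordinal (l_lt : l < x.+1)) (Ordinal (nvectors_gt0 k m x)) => /= ->.
by apply: rk_init; rewrite /game_init /= l_init.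
Qed.

Lemma tabulated_eps : cert_eps k m x (table k m x y).
Proof.
have [_ rk_eps _] := measure.
move=> p p_lt _ /bool_of_lt2[f ->] _ /bool_of_lt2[f' ->] _ _ /rule_of_code[r r_in ->].
rewrite !rule_codeE => lab_r /flag_codeP flag_f' u u_lt w w_lt u' u'_lt edge_u.
have [_ src_lt _ dst_lt] := rule_bound r_in.
have := tab (Ordinal p_lt) f (Ordinal (src_lt : _ < x.+1)) (Ordinal u_lt) => /= ->.
have := tab (Ordinal p_lt) f' (Ordinal (dst_lt : _ < x.+1)) (Ordinal u'_lt) => /= ->.
move=> rank_gt0; apply/andP; apply: rk_eps rank_gt0; apply/asboolP; exists r, w; split=> //.
by move: lab_r; case: (r_lab r) => // -[].
Qed.

Lemma tabulated_letter : cert_letter k m x (table k m x y).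
Proof.
have [_ _ rk_letter] := measure.
move=> p p_lt a; rewrite !instance_codeE => a_lt c c_lt.
have [[b Y] [p' rk_p']] := rk_letter (Ordinal p_lt) (Ordinal a_lt, Ordinal c_lt).
exists b; split=> //; exists Y; split=> //; exists p'; split=> //.
move=> _ /bool_of_lt2[f ->] _ /bool_of_lt2[f' ->] _ _ /rule_of_code[r r_in ->].
rewrite !rule_codeE => lab_r /flag_codeP flag_f' u u_lt w w_lt u' u'_lt edge_u w_c.
have [_ src_lt _ dst_lt] := rule_bound r_in.
have := tab (Ordinal p_lt) f (Ordinal (src_lt : _ < x.+1)) (Ordinal u_lt) => /= ->.
have := tab p' false (Ordinal (dst_lt : _ < x.+1)) (Ordinal u'_lt) => /= ->.
move=> rank_gt0; apply: rk_p' rank_gt0; apply/asboolP; exists r, w; split=> //.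
by move: lab_r; case: (r_lab r) => // -[a' b'] [] /cpair_inj[-> ->].
Qed.
End Tabulation.

Lemma card_game_state : #|{: game_state}| = nstates k m x.
Proof. by rewrite !card_prod card_bool !card_ord. Qed.

Theorem controller_certificate : has_winning_controller k m I -> has_certificate k m x.
Proof.
case=> L [l0 [delta [invariant winning_ctrl]]].
have [subset_code subset_codeE] := choice (@subset_code_exists k).
have := bounded_progress_measure (controller_winning invariant winning_ctrl subset_codeE).
rewrite -[#|_|]/(#|{: game_state}|) card_game_state -/(nmemory k m x) => -[p0 [rk [measure rk_le]]].
have [y [y_lt tab]] := tabulates_exists rk_le.
exists y; split=> //; split; first exact: (tabulated_init measure tab).
by split; [exact: (tabulated_eps measure tab)|exact: (tabulated_letter measure tab)].
Qed.
End RegionGame.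

Theorem theorem2 :
  forall k m : nat,
    computably_decidable enc_instance (fun I : instance => has_winning_controller k m I).
Proof.
move=> k m; apply: computably_decidable_enc (decidable_has_certificate k m) _ => I.
split; first exact: controller_certificate.
by case=> y [_ cert]; apply: certificate_controller cert.
Qed.
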